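(* Assume the global noise law, the edge condition, and the real subspace local law (all defined in the context). Fix $\delta>0$ and $M>\theta_\star+\delta$, and assume weighted compatibility on a compact interval $I\subset(b,\infty)$ containing a fixed neighborhood of $\rho([\theta_\star+\delta,M])$. Define $$I_{n,\delta,M}:=\{i:\theta_\star+\delta\le\theta_{n,i}\le M\},\qquad k_{n,\delta}:=\#\{i:\theta_{n,i}\ge\theta_\star+\delta\}.$$ Then there is a deterministic $\eta_n(\delta,M)\downarrow0$ such that, with probability $1-o(1)$, $$\max_{i\in I_{n,\delta,M}}|\sigma_i(W_n)-\rho(\theta_{n,i})|\le\eta_n(\delta,M),$$ where the maximum over the empty set is zero. In addition, assuming weighted compatibility on a neighborhood of $\rho(\theta_\star+\delta)$, with probability $1-o(1)$ $$\sigma_{k_{n,\delta}+1}(W_n)\le\rho(\theta_\star+\delta)+\eta_n(\delta,M).$$ No upper bound is imposed on spike strengths outside $[\theta_\star+\delta,M]$, and no separation among the spike strengths is required. In particular, if $\|\Theta_n\|_{\mathrm{op}}\le M$, then the first bound covers every index $i\le k_{n,\delta}$, and it is equivalent to $d_{\mathrm{bot}}(A_n,B_n)\le\eta_n(\delta,M)$ for the multisets $A_n=\{\sigma_i(W_n):i\le k_{n,\delta}\}$ and $B_n=\{\rho(\theta_{n,i}):i\le k_{n,\delta}\}$.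
   Context: Setting. $\mathbb F\in\{\mathbb R,\mathbb C\}$; for each $n$, $m=m(n)\ge n$ is an integer and $n/m\to c\in(0,1]$. $X_n$ is a random $n\times m$ matrix over $\mathbb F$; $P_n$ is an $n\times m$ matrix of rank $r_n$ (deterministic, or random on the same probability space; neither independence from $X_n$ nor any rank restriction is assumed); $W_n=X_n+P_n$. With $\mathrm{St}(N,r)=\{Q\in\mathbb F^{N\times r}:Q^*Q=I_r\}$, fix a thin singular value decomposition $P_n=U_n\Theta_nV_n^*$, $U_n\in\mathrm{St}(n,r_n)$, $V_n\in\mathrm{St}(m,r_n)$, $\Theta_n=\operatorname{diag}(\theta_{n,1},\dots,\theta_{n,r_n})$, $\theta_{n,1}\ge\dots\ge\theta_{n,r_n}>0$. $\sigma_1(W_n)\ge\dots\ge\sigma_n(W_n)$ are the singular values of $W_n$, and $\sigma_{n+1}(W_n):=0$. The notation $\eta_n\downarrow0$ means a nonnegative sequence tending to $0$. Bottleneck distance. For finite multisets $A=\{a_1\ge\dots\ge a_k\}$, $B=\{b_1\ge\dots\ge b_k\}$ of equal size, $d_{\mathrm{bot}}(A,B)=\max_{1\le j\le k}|a_j-b_j|$. Global noise law. There is a compactly supported probability measure $\mu$ on $[0,\infty)$ such that the empirical spectral measure of $X_nX_n^*$ converges weakly to $\mu$ in probability and $\|X_n\|_{\mathrm{op}}\to b:=\sqrt{\sup\operatorname{supp}\mu}$ in probability. Transforms. For $\zeta\in\mathbb C\setminus[-b,b]$: $\phi(\zeta)=\int\frac{\zeta}{\zeta^2-x}\,\mu(dx)$,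 $\widetilde\phi(\zeta)=c\,\phi(\zeta)+\frac{1-c}{\zeta}$, $d(\zeta)=\phi(\zeta)\widetilde\phi(\zeta)$. On $(b,\infty)$, $d$ is positive and strictly decreasing. Edge condition. $d(b+):=\lim_{z\downarrow b}d(z)\in(0,\infty)$. Put $\theta_\star=d(b+)^{-1/2}$; $\rho(\theta)=d^{-1}(\theta^{-2})$ (inverse of $d$ on $(b,\infty)$) for $\theta>\theta_\star$ and $\rho(\theta)=b$ for $0\le\theta\le\theta_\star$. Linearization. $\mathcal X_n=\begin{pmatrix}0&X_n\\ X_n^*&0\end{pmatrix}$, $\mathcal E_n=\begin{pmatrix}U_n&0\\0&V_n\end{pmatrix}$, $\mathcal K_n=\begin{pmatrix}0&\Theta_n\\\Theta_n&0\end{pmatrix}$, $\mathcal G_n(\zeta)=\mathcal E_n^*(\zeta I-\mathcal X_n)^{-1}\mathcal E_n$, $\mathcal M(\zeta)=\begin{pmatrix}\phi(\zeta)I_{r_n}&0\\0&\widetilde\phi(\zeta)I_{r_n}\end{pmatrix}$. Real subspace local law. For every compact interval $I\subset(b,\infty)$ there is a deterministic $\varepsilon_n(I)\downarrow0$ such that $\mathbb P\big(\|X_n\|_{\mathrm{op}}<\inf I,\ \sup_{z\in I}\|\mathcal G_n(z)-\mathcal M(z)\|_{\mathrm{op}}\le\varepsilon_n(I)\big)\to1$. Weighted compatibility on a compact set $K\subset\mathbb C\setminus[-b,b]$: $\sup_{\zeta\in K}\big(\|(\mathcal G_n(\zeta)-\mathcal M(\zeta))\mathcal K_n\|_{\mathrm{op}}+\|\mathcal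 K_n(\mathcal G_n(\zeta)-\mathcal M(\zeta))\|_{\mathrm{op}}\big)\to0$ in probability (the supremum being $+\infty$ if $\mathcal G_n$ is undefined somewhere on $K$). Weighted compatibility on a neighborhood of a point of $(b,\infty)$ means on some compact interval in $(b,\infty)$ containing that point in its interior. *)

(* Defs.v *)
From HB Require Import structures.
From mathcomp Require Import all_boot all_order all_algebra.
From mathcomp Require Import complex.
From mathcomp Require Import all_classical all_reals all_analysis.

Set Implicit Arguments.
Unset Strict Implicit.
Unset Printing Implicit Defensive.

Import Order.TTheory GRing.Theory Num.Theory.
Import numFieldNormedType.Exports.

Local Open Scope classical_set_scope.
Local Open Scope complex_scope.
Local Open Scope sesquilinear_scope.
Local Open Scope ring_scope.

(* Matrices over either field are represented as complex matrices: a real      *)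
(* matrix is a complex one with real entries.  Its operator norm and singular  *)
(* values are the same over both fields.                                       *)
Variant base_field := RealField | ComplexField.

Definition entries_over (R : realType) (F : base_field) (p q : nat)
    (A : 'M[R[i]]_(p, q)) : Prop :=
  match F with
  | RealField => A \is a realmx
  | ComplexField => True
  end.

Section LinearAlgebra.
Context {R : realType}.

Definition enorm p (x : 'cV[R[i]]_p) : R :=
  Num.sqrt (\sum_i (complex.Re (x i 0) ^+ 2 + complex.Im (x i 0) ^+ 2)).

Definition opnorm p q (A : 'M[R[i]]_(p, q)) : R :=
  sup [set enorm (A *m x) | x in [set x : 'cV[R[i]]_q | enorm x <= 1]].

(* Eigenvalues of a Hermitian matrix, with multiplicity, in decreasing order.  *)
Definition eigenvalues p (A : 'M[R[i]]_p) : seq R :=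
  sort >=%R [seq complex.Re (spectral_diag A 0 i) | i <- enum 'I_p].

(* Singular values of a p x q matrix with p <= q.  They are numbered from 0:   *)
(* [sigma A i] is $\sigma_{i+1}(A)$, and it is 0 for i >= p.                   *)
Definition sigma p q (A : 'M[R[i]]_(p, q)) (i : nat) : R :=
  nth 0 [seq Num.sqrt x | x <- eigenvalues (A *m A ^t*)] i.

Definition esd p (A : 'M[R[i]]_p) : set (measurableTypeR R) -> \bar R :=
  mscale (p%:R^-1)%:nng
    (msum (fun i => \d_(nth 0 (eigenvalues A) i : measurableTypeR R)) p).

HB.instance Definition _ p (A : 'M[R[i]]_p) := Measure.on (esd A).

Definition rdiag r (t : 'rV[R]_r) : 'M[R[i]]_r := diag_mx (map_mx (real_complex R) t).

(* The indices of [svd_theta] start at 0 as well.                              *)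
Record thin_svd (F : base_field) p q (A : 'M[R[i]]_(p, q)) := ThinSVD {
  svd_U : 'M[R[i]]_(p, \rank A);
  svd_V : 'M[R[i]]_(q, \rank A);
  svd_theta : 'rV[R]_(\rank A);
  svd_U_over : entries_over F svd_U;
  svd_V_over : entries_over F svd_V;
  svd_U_orth : svd_U ^t* *m svd_U = 1%:M;
  svd_V_orth : svd_V ^t* *m svd_V = 1%:M;
  svd_theta_gt0 : forall i, 0 < svd_theta 0 i;
  svd_theta_noninc : forall i j : 'I_(\rank A),
    (i <= j)%N -> svd_theta 0 j <= svd_theta 0 i;
  svd_eq : A = svd_U *m rdiag svd_theta *m svd_V ^t*
}.

Definition spikes_in (F : base_field) p q (A : 'M[R[i]]_(p, q))
    (S : thin_svd F A) (lo hi : R) : pred 'I_(\rank A) :=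
  [pred i | lo <= svd_theta S 0 i <= hi].

Definition spike_count (F : base_field) p q (A : 'M[R[i]]_(p, q))
    (S : thin_svd F A) (lo : R) : nat :=
  #|[pred i | lo <= svd_theta S 0 i]|.

(* Bottleneck distance of two multisets of the same size, given as sequences.  *)
Definition bottleneck (A B : seq R) : R :=
  \big[Num.max/0]_(j < size A)
    `|nth 0 (sort >=%R A) j - nth 0 (sort >=%R B) j|.

Definition linearization p q (X : 'M[R[i]]_(p, q)) : 'M[R[i]]_(p + q) :=
  block_mx 0 X (X ^t*) 0.

Section Compressed.
Variables (F : base_field) (p q : nat) (X P : 'M[R[i]]_(p, q)).
Variable (S : thin_svd F P).

Definition frame : 'M[R[i]]_(p + q, \rank P + \rank P) :=
  block_mx (svd_U S) 0 0 (svd_V S).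

Definition weight : 'M[R[i]]_(\rank P + \rank P) :=
  block_mx 0 (rdiag (svd_theta S)) (rdiag (svd_theta S)) 0.

Definition resolvent_defined (z : R[i]) : bool :=
  z%:M - linearization X \in unitmx.

Definition compressed_resolvent (z : R[i]) : 'M[R[i]]_(\rank P + \rank P) :=
  frame ^t* *m invmx (z%:M - linearization X) *m frame.

End Compressed.
End LinearAlgebra.

Arguments weight {R F p q P} S.

Section LimitLaw.
Context {R : realType}.
Variables (mu : probability (measurableTypeR R) R) (c : R).

Definition supp : set R := [set x | forall e : R, 0 < e -> (0 < mu (ball x e))%E].

Definition edge : R := Num.sqrt (sup supp).

Definition phi (z : R[i]) : R[i] :=
  let f (x : R) : R[i] := z / (z ^+ 2 - x%:C) in
  (\int[mu]_x complex.Re (f x)) +i* (\int[mu]_x complex.Im (f x)).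

Definition phit (z : R[i]) : R[i] := c%:C * phi z + (1 - c)%:C / z.

Definition dtrans (z : R[i]) : R[i] := phi z * phit z.

(* [dtrans] takes real values at the real points outside [-edge, edge].        *)
Definition dreal (z : R) : R := complex.Re (dtrans z%:C).

Definition d_edge : R := lim (dreal z @[z --> edge^'+]).

Definition edge_condition : Prop :=
  cvg (dreal z @[z --> edge^'+]) /\ 0 < d_edge.

Definition theta_star : R := (Num.sqrt d_edge)^-1.

Definition dinv (y : R) : R := xget edge [set z | edge < z /\ dreal z = y].

Definition rho (t : R) : R := if theta_star < t then dinv (t ^- 2) else edge.


Definition Mlim r (z : R[i]) : 'M[R[i]]_(r + r) :=
  block_mx (phi z)%:M 0 0 (phit z)%:M.

End LimitLaw.

Definition null_seq {R : realType} (u : nat -> R) : Prop :=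
  (forall n, 0 <= u n) /\ u n @[n --> \oo] --> (0 : R).

Section Asymptotics.
Context {R : realType}.
Variables (disp : nat -> measure_display) (Om : forall n, measurableType (disp n)).
Variable (Pr : forall n, probability (Om n) R).

(* "With probability 1 - o(1)".  For measurable events this is                 *)
(* Pr n (E n) --> 1; in general it is convergence of the inner probabilities,  *)
(* so that no measurability of the chosen singular vectors is needed.          *)
Definition whp (E : forall n, set (Om n)) : Prop :=
  exists A : forall n, set (Om n),
    [/\ forall n, measurable (A n),
        forall n, A n `<=` E n &
        Pr n (A n) @[n --> \oo] --> 1%E].

Definition cvg_in_probability (Y : forall n, Om n -> \bar R) (y : R) : Prop :=
  forall e : R, 0 < e -> whp (fun n => [set w | (`|Y n w - y%:E| <= e%:E)%E]).

Variables (m : nat -> nat) (X P : forall n, Om n -> 'M[R[i]]_(n, m n)).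

Definition random_matrix : Prop := forall n i j,
  measurable_fun setT (fun w => complex.Re (X w i j) : measurableTypeR R) /\
  measurable_fun setT (fun w => complex.Im (@X n w i j) : measurableTypeR R).

Variables (mu : probability (measurableTypeR R) R) (c : R).

Definition global_noise_law : Prop :=
  [/\ mu `[0, +oo[%classic = 1%E,
      compact (supp mu),
      forall f : R -> R, continuous f -> (exists K, forall x, `|f x| <= K) ->
        cvg_in_probability
          (fun n w => (\int[esd (@X n w *m (@X n w) ^t*)]_x f x)%:E)
          (\int[mu]_x f x) &
      cvg_in_probability (fun n w => (opnorm (@X n w))%:E) (edge mu)].

Variables (F : base_field) (S : forall n w, thin_svd F (@P n w)).

Definition deviation n w (z : R[i]) : 'M[R[i]]_(\rank (P w) + \rank (P w)) :=
  compressed_resolvent (X w) (@S n w) z - Mlim mu c _ z.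

(* Compact intervals are given by their endpoints a1 <= a2.                    *)
Definition real_subspace_local_law : Prop :=
  forall a1 a2 : R, edge mu < a1 -> a1 <= a2 ->
  exists eps : nat -> R, null_seq eps /\
    whp (fun n => [set w | opnorm (X w) < a1 /\
      (ereal_sup [set (opnorm (@deviation n w z%:C))%:E | z in `[a1, a2]]
        <= (eps n)%:E)%E]).

Definition weighted_deviation n w (z : R[i]) : \bar R :=
  if resolvent_defined (X w) z then
    (opnorm (@deviation n w z *m weight (S w)) +
     opnorm (weight (S w) *m deviation w z))%:E
  else +oo%E.

Definition weighted_compatibility (K : set R[i]) : Prop :=
  cvg_in_probability
    (fun n w => ereal_sup [set @weighted_deviation n w z | z in K]) 0.

Definition weighted_compatibility_near (x : R) : Prop :=
  exists a1 a2 : R, [/\ edge mu < a1, a1 < x, x < a2 &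
    weighted_compatibility (real_complex R @` `[a1, a2])].

End Asymptotics.

(* Main.v *)
Require Import Defs.
From HB Require Import structures.
From mathcomp Require Import all_boot all_order all_algebra.
From mathcomp Require Import complex ring lra.
From mathcomp Require Import all_classical all_reals all_analysis.
From mathcomp Require Import measurable_realfun.

Set Implicit Arguments.
Unset Strict Implicit.
Unset Printing Implicit Defensive.

Import Order.TTheory GRing.Theory Num.Theory.
Import numFieldNormedType.Exports.

Local Open Scope classical_set_scope.
Local Open Scope complex_scope.
Local Open Scope sesquilinear_scope.
Local Open Scope ring_scope.

(** Let [H = z - lin X], where [lin] is the Hermitian dilation, [E] the frame
    and [K] the weight of [P], and [G = E^* H^-1 E].  For [z > |X|] the matrix
    [H] is positive definite, and the number of singular values of [X + P] above
    [z] is the number of negative directions of [z - lin (X + P) = H - E K E^*].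
    This number can be compared with that of the limiting problem by bounding
    quadratic forms only, so that neither a bound on the spikes, nor a
    separation between them, nor a bound on their number enters.

    Suppose [diag(s, t)] dominates [G], with [s, t > 0].  Completing the square
    gives [H >= E diag(s, t)^-1 E^*].  For the right and left directions of a
    spike [theta], the form with matrix [(1/s, -theta; -theta, 1/t)] is
    nonnegative as soon as [theta^2 s t <= 1].  Hence at most as many singular
    values exceed [z] as there are spikes with [theta^2 s t > 1]
    ([sigma_perturbed_le]).  Suppose instead that [G] dominates [diag(s, t)].
    Then test vectors built from [H^-1 E G^-1] show that at least as many
    singular values exceed [z] as there are spikes with [theta^2 s t > 1]
    ([sigma_perturbed_gt]).  Both rest on the two halves of the Courant-Fischer
    theorem ([sigma_gt], [sigma_le]).

    The local law allows [s, t = phi(z) +- e, phit(z) +- e] with [e] small and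
    uniform in [z].  As [phi] and [phit] decrease at least as fast as [1/z], on
    [z <= beta] the error [e] is absorbed by a displacement [eta >= beta^2 e]
    of the point: [(phi + e) (phit + e)] at [rho(theta) + eta] is at most
    [d (rho(theta)) = theta^-2], and dually at [rho(theta) - eta]
    ([sigma_le_rho], [sigma_gt_rho]).  Every spike [theta_j] with [j] beyond [i]
    is at most [theta_i], so that [sigma_i <= rho(theta_i) + eta]; every spike
    with [j] up to [i] is at least [theta_i], so that
    [sigma_i > rho(theta_i) - eta].  The bound on the first singular value
    behind the [k] large ones is the first inequality at [theta = lo]. *)

(** * The real inner product and the operator norm *)

(** The real part of the Hermitian product turns [C^p] into a real Euclidean
    space with the same norms and adjoints, in which all the quadratic forms
    used below take real values. *)
HB.lock Definition cdot (R : realType) p (x y : 'cV[R[i]]_p) : R :=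
  complex.Re ((x ^t* *m y) 0 0).
Arguments cdot {R p} x y.

Section RealInnerProduct.
Context {R : realType}.
Local Notation C := R[i].

Lemma cdotE p (x y : 'cV[C]_p) :
  cdot x y = \sum_i (complex.Re (x i 0) * complex.Re (y i 0) +
                     complex.Im (x i 0) * complex.Im (y i 0)).
Proof.
rewrite cdot.unlock mxE raddf_sum; apply: eq_bigr => i _.
by rewrite !mxE; case: (x i 0) => a b; case: (y i 0) => c d /=; ring.
Qed.

Lemma cdotC p (x y : 'cV[C]_p) : cdot x y = cdot y x.
Proof. by rewrite !cdotE; apply: eq_bigr => i _; ring. Qed.

Lemma cdotDr p (x y z : 'cV[C]_p) : cdot x (y + z) = cdot x y + cdot x z.
Proof. by rewrite cdot.unlock mulmxDr mxE raddfD. Qed.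

Lemma cdotNr p (x y : 'cV[C]_p) : cdot x (- y) = - cdot x y.
Proof. by rewrite cdot.unlock mulmxN mxE raddfN. Qed.

Lemma cdotDl p (x y z : 'cV[C]_p) : cdot (x + y) z = cdot x z + cdot y z.
Proof. by rewrite cdotC cdotDr ![cdot z _]cdotC. Qed.

Lemma cdotNl p (x y : 'cV[C]_p) : cdot (- x) y = - cdot x y.
Proof. by rewrite cdotC cdotNr cdotC. Qed.

Lemma cdotBr p (x y z : 'cV[C]_p) : cdot x (y - z) = cdot x y - cdot x z.
Proof. by rewrite cdotDr cdotNr. Qed.

Lemma cdotBl p (x y z : 'cV[C]_p) : cdot (x - y) z = cdot x z - cdot y z.
Proof. by rewrite cdotDl cdotNl. Qed.

Lemma cdotZr p a (x y : 'cV[C]_p) : cdot x (a%:C *: y) = a * cdot x y.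
Proof.
by rewrite cdot.unlock -scalemxAr mxE; case: (_ 0 0) => u v /=; rewrite mul0r subr0.
Qed.

Lemma cdotZl p a (x y : 'cV[C]_p) : cdot (a%:C *: x) y = a * cdot x y.
Proof. by rewrite cdotC cdotZr cdotC. Qed.

Lemma cdot0r p (x : 'cV[C]_p) : cdot x 0 = 0.
Proof. by rewrite cdot.unlock mulmx0 mxE. Qed.

Lemma cdot0l p (x : 'cV[C]_p) : cdot 0 x = 0.
Proof. by rewrite cdotC cdot0r. Qed.

Lemma cdot_adjr p q (A : 'M[C]_(p, q)) x y :
  cdot x (A *m y) = cdot (A ^t* *m x) y.
Proof.
by rewrite cdot.unlock trmx_mul map_mxM/= trmxCK mulmxA.
Qed.

Lemma cdot_adjl p q (A : 'M[C]_(p, q)) x y :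
  cdot x (A ^t* *m y) = cdot (A *m x) y.
Proof. by rewrite cdotC -cdot_adjr cdotC. Qed.

Lemma cdot_col_mx p q (a c : 'cV[C]_p) (b d : 'cV[C]_q) :
  cdot (col_mx a b) (col_mx c d) = cdot a c + cdot b d.
Proof. by rewrite cdot.unlock tr_col_mx map_row_mx mul_row_col mxE raddfD. Qed.

Lemma cdot_ge0 p (x : 'cV[C]_p) : 0 <= cdot x x.
Proof.
by rewrite cdotE sumr_ge0 // => i _; rewrite -!expr2 addr_ge0 ?sqr_ge0.
Qed.

Lemma cdot_eq0 p (x : 'cV[C]_p) : (cdot x x == 0) = (x == 0).
Proof.
apply/eqP/eqP=> [|->]; last exact: cdot0r.
rewrite cdotE => /psumr_eq0P H; apply/colP => i; rewrite mxE.
have /H -/(_ i isT) : forall i, true ->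
    0 <= complex.Re (x i 0) * complex.Re (x i 0) +
         complex.Im (x i 0) * complex.Im (x i 0).
  by move=> j _; rewrite -!expr2 addr_ge0 ?sqr_ge0.
move/eqP; rewrite -!expr2 paddr_eq0 ?sqr_ge0// !sqrf_eq0 => /andP[/eqP a /eqP b].
by apply/eqP; rewrite eq_complex a b !eqxx.
Qed.

Lemma cdot_gt0 p (x : 'cV[C]_p) : (0 < cdot x x) = (x != 0).
Proof. by rewrite lt_def cdot_ge0 andbT cdot_eq0. Qed.

Lemma enorm_sqr p (x : 'cV[C]_p) : enorm x ^+ 2 = cdot x x.
Proof.
rewrite /enorm sqr_sqrtr; last first.
  by rewrite sumr_ge0 // => i _; rewrite addr_ge0 ?sqr_ge0.
by rewrite cdotE; apply: eq_bigr => i _; rewrite !expr2.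
Qed.

Lemma enormE p (x : 'cV[C]_p) : enorm x = Num.sqrt (cdot x x).
Proof. by rewrite -enorm_sqr sqrtr_sqr ger0_norm // sqrtr_ge0. Qed.

Lemma enorm_ge0 p (x : 'cV[C]_p) : 0 <= enorm x.
Proof. exact: sqrtr_ge0. Qed.

Lemma enormZ p (a : R) (x : 'cV[C]_p) : enorm (a%:C *: x) = `|a| * enorm x.
Proof.
by rewrite !enormE cdotZl cdotZr mulrA -expr2 sqrtrM ?sqr_ge0// sqrtr_sqr.
Qed.

Lemma enorm_eq0 p (x : 'cV[C]_p) : (enorm x == 0) = (x == 0).
Proof. by rewrite -cdot_eq0 -enorm_sqr sqrf_eq0. Qed.

(** This is [|s x - y|^2 >= 0] divided by [s]; the free weight makes it sharp
    both for Cauchy-Schwarz and for forms with matrix [diag(s, t)]. *)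
Lemma cdot_amgm p (s : R) (x y : 'cV[C]_p) : 0 < s ->
  2 * cdot x y <= s * cdot x x + s^-1 * cdot y y.
Proof.
move=> s0; have := cdot_ge0 (s%:C *: x - y).
rewrite cdotBl !cdotBr !cdotZl !cdotZr (cdotC y x).
move: (cdot x x) (cdot x y) (cdot y y) => a b c H.
rewrite -(ler_pM2l s0) mulrDr (mulrA s s^-1) divff ?gt_eqF// mul1r; lra.
Qed.

Lemma cdot_le_enorm p (x y : 'cV[C]_p) : cdot x y <= enorm x * enorm y.
Proof.
have [->|x0] := eqVneq x 0.
  by rewrite cdot0l mulr_ge0 ?enorm_ge0.
have [->|y0] := eqVneq y 0; first by rewrite cdot0r mulr_ge0 ?enorm_ge0.
have nx : 0 < enorm x by rewrite lt_def enorm_ge0 enorm_eq0 x0.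
have ny : 0 < enorm y by rewrite lt_def enorm_ge0 enorm_eq0 y0.
have /(cdot_amgm x y) : 0 < enorm y / enorm x by rewrite divr_gt0.
rewrite -!enorm_sqr invf_div.
have -> : enorm y / enorm x * enorm x ^+ 2 + enorm x / enorm y * enorm y ^+ 2 =
  2 * (enorm x * enorm y) by field; rewrite !gt_eqF.
by rewrite ler_pM2l.
Qed.

Lemma cdot_geN_enorm p (x y : 'cV[C]_p) : - (enorm x * enorm y) <= cdot x y.
Proof.
have := cdot_le_enorm (- x) y; rewrite cdotNl lerNl.
by rewrite enormE cdotNl cdotNr opprK -enormE.
Qed.

(** By Cauchy-Schwarz applied to the rows: the real part of an entry of [A x] is
    the product of [x] with a row of [A], the imaginary part that of [-i x]. *)
Lemma enorm_mulmx_bounded p q (A : 'M[C]_(p, q)) :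
  exists K : R, forall x, enorm (A *m x) <= K * enorm x.
Proof.
pose a i : 'cV[C]_q := (row i A) ^t*.
exists (Num.sqrt (\sum_i (2 * cdot (a i) (a i)))) => x.
have e i : (A *m x) i 0 = ((a i) ^t* *m x) 0 0.
  by rewrite /a trmxCK -row_mul [RHS]mxE.
have eRe i : complex.Re ((A *m x) i 0) = cdot (a i) x by rewrite e cdot.unlock.
have eIm i : complex.Im ((A *m x) i 0) = cdot (a i) (- 'i *: x).
  rewrite e cdot.unlock -scalemxAr [X in _ = complex.Re X]mxE.
  by case: (_ 0 0) => u v /=; ring.
have nI : enorm (- 'i *: x) = enorm x.
  rewrite /enorm; congr Num.sqrt; apply: eq_bigr => i _; rewrite mxE.
  by case: (x i 0) => u v /=; ring.
rewrite -[enorm x]ger0_norm ?enorm_ge0// -sqrtr_sqr -sqrtrM; last first.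
  by rewrite sumr_ge0 // => i _; rewrite mulr_ge0 ?cdot_ge0.
rewrite /enorm ler_wsqrtr // mulr_suml ler_sum // => i _.
have -> : 2 * cdot (a i) (a i) * enorm x ^+ 2 =
   (enorm (a i) * enorm x) ^+ 2 + (enorm (a i) * enorm x) ^+ 2.
  by rewrite -enorm_sqr; ring.
have sq (u v : R) : 0 <= v -> - v <= u -> u <= v -> u ^+ 2 <= v ^+ 2.
  move=> v0 uv vu; rewrite -subr_ge0.
  have -> : v ^+ 2 - u ^+ 2 = (v - u) * (u - - v) by ring.
  by rewrite mulr_ge0 ?subr_ge0.
apply: lerD; apply: sq; rewrite ?mulr_ge0 ?enorm_ge0 //.
- by rewrite eRe; apply: cdot_geN_enorm.
- by rewrite eRe; apply: cdot_le_enorm.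
- by rewrite eIm -nI; apply: cdot_geN_enorm.
- by rewrite eIm -nI; apply: cdot_le_enorm.
Qed.

Lemma opnorm_has_ubound p q (A : 'M[C]_(p, q)) :
  has_ubound [set enorm (A *m x) | x in [set x : 'cV[C]_q | enorm x <= 1]].
Proof.
have [K HK] := enorm_mulmx_bounded A.
exists `|K| => _ [y /= y1 <-]; apply: (le_trans (HK y)).
apply: (@le_trans _ _ (`|K| * enorm y)).
  by rewrite ler_wpM2r ?enorm_ge0// ler_norm.
by rewrite -[leRHS]mulr1 ler_wpM2l.
Qed.

Lemma opnorm_ge0 p q (A : 'M[C]_(p, q)) : 0 <= opnorm A.
Proof.
apply: ub_le_sup; first exact: opnorm_has_ubound.
by exists 0; rewrite /= ?mulmx0 enormE cdot0l sqrtr0.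
Qed.

Lemma enorm_mulmx_le p q (A : 'M[C]_(p, q)) x :
  enorm (A *m x) <= opnorm A * enorm x.
Proof.
have [->|x0] := eqVneq x 0.
  by rewrite mulmx0 !enormE !cdot0l !sqrtr0 mulr0.
have nx : 0 < enorm x by rewrite lt_def enorm_ge0 enorm_eq0 x0.
rewrite -ler_pdivrMr// mulrC -[X in X * _]ger0_norm ?invr_ge0 ?enorm_ge0//.
rewrite -enormZ scalemxAr.
apply: ub_le_sup; first exact: opnorm_has_ubound.
exists ((enorm x)^-1%:C *: x) => //=.
by rewrite enormZ ger0_norm ?invr_ge0 ?enorm_ge0// mulVf ?gt_eqF.
Qed.

Lemma kernel_vector p q (A : 'M[C]_(p, q)) : (\rank A < q)%N ->
  exists2 x : 'cV[C]_q, x != 0 & A *m x = 0.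
Proof.
move=> rA.
have : kermx A^T != 0.
  by rewrite -mxrank_eq0 mxrank_ker mxrank_tr subn_eq0 -ltnNge.
case/rowV0Pn => v /sub_kermxP vA v0; exists v^T.
  by rewrite -(inj_eq trmx_inj) trmx0 trmxK.
by apply: trmx_inj; rewrite trmx_mul trmxK vA trmx0.
Qed.

Lemma posdef_unitmx p (A : 'M[C]_p) :
  (forall x, x != 0 -> 0 < cdot x (A *m x)) -> A \in unitmx.
Proof.
move=> pA; rewrite -row_full_unit /row_full eqn_leq rank_leq_col leqNgt /=.
apply/negP => /kernel_vector[x x0 Ax].
by have := pA x x0; rewrite Ax cdot0r ltxx.
Qed.

End RealInnerProduct.

(** * Courant-Fischer bounds for singular values *)

Lemma sorted_lt_nth (R : realType) (s : seq R) i (t : R) :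
  sorted >=%R s -> (i < size s)%N ->
  (t < nth 0 s i) = (i < count (fun x => t < x)%R s)%N.
Proof.
elim: s i => // x s IH i /= xs si.
have [tx|xt] := ltP t x.
  by case: i si => [|i] si /=; rewrite ?tx ?IH ?(path_sorted xs).
have sx : all (fun y => y <= t) s.
  move: xs; rewrite path_sortedE; last by move=> a b c ab bc; apply: le_trans bc ab.
  case/andP => /allP xs _; apply/allP => y /xs /= yx; exact: le_trans yx xt.
have -> : count (fun x => t < x) s = 0%N.
  apply/eqP; rewrite -leqn0 leqNgt -has_count; apply/hasPn => y ys.
  by rewrite -leNgt (allP sx).
rewrite ltn0; apply/negbTE; rewrite -leNgt.
case: i si => [|i] //= si; apply: (allP sx); exact: mem_nth.
Qed.

Section CourantFischer.
Context {R : realType} {p q : nat}.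
Local Notation C := R[i].
Variable W : 'M[C]_(p, q).

Let A := W *m W ^t*.
Let Q := spectralmx A.
Let lam j : R := complex.Re (spectral_diag A 0 j).

Let adjQ x : Q ^t* *m (Q *m x) = x :> 'cV_p.
Proof.
by rewrite mulmxA -invmx_unitary ?spectral_unitarymx// mulVmx ?mul1mx ?spectral_unit.
Qed.

Let adjQr x : Q *m (Q ^t* *m x) = x :> 'cV_p.
Proof.
by rewrite mulmxA -invmx_unitary ?spectral_unitarymx// mulmxV ?mul1mx ?spectral_unit.
Qed.

Let sqn (z : C) : R := complex.Re z ^+ 2 + complex.Im z ^+ 2.

Let cdot_sqn (x : 'cV[C]_p) : cdot x x = \sum_j sqn ((Q *m x) j 0).
Proof.
by rewrite -{1}[x]adjQ -cdot_adjr cdotE; apply: eq_bigr => j _; rewrite /sqn !expr2.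
Qed.

Let cdot_lam (x : 'cV[C]_p) :
  cdot (W ^t* *m x) (W ^t* *m x) = \sum_j lam j * sqn ((Q *m x) j 0).
Proof.
have hA : A \is hermsymmx.
  by apply/is_hermitianmxP; rewrite expr0 scale1r /A trmx_mul map_mxM/= trmxCK.
have AE : A = Q ^t* *m diag_mx (spectral_diag A) *m Q.
  have /hermitian_normalmx /orthomx_spectralP {1}-> := hA.
  by rewrite -invmx_unitary ?spectral_unitarymx.
have realA := hermitian_spectral_diag_real hA.
rewrite -cdot_adjr mulmxA -/A AE -!mulmxA cdot_adjl cdotE.
apply: eq_bigr => j _; rewrite mul_diag_mx [(\matrix_(_, _) _) _ _]mxE /lam /sqn.
have : spectral_diag A 0 j \is Num.real by exact: (mxOverP realA).
case: (spectral_diag A 0 j) => a b /complex_realP[c [-> ->]].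
by case: (_ j 0) => u v /=; ring.
Qed.

Let top (z : R) : {set 'I_p} := finset (fun j => z ^+ 2 < lam j).

Let lt_sigma z i : 0 <= z -> (z < sigma W i) = (i < #|top z|)%N.
Proof.
move=> z0.
have se : size (eigenvalues A) = p by rewrite size_sort size_map size_enum_ord.
have [pi|ip] := leqP p i.
  rewrite /sigma nth_default ?size_map ?se//.
  rewrite ltNge z0 /=; apply/esym/negbTE; rewrite -leqNgt.
  by rewrite (leq_trans _ pi)// (leq_trans (max_card _))// card_ord.
rewrite /sigma (nth_map 0) ?se// -/A.
have -> : (z < Num.sqrt (nth 0 (eigenvalues A) i)) =
          (z ^+ 2 < nth 0 (eigenvalues A) i).
  have [x0|x0] := leP (nth 0 (eigenvalues A) i) 0.
    rewrite ler0_sqrtr// !ltNge z0 /=; apply/esym/negbTE; rewrite negbK.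
    by rewrite (le_trans x0) ?sqr_ge0.
  by rewrite -{1}[z]ger0_norm// -sqrtr_sqr ltr_sqrt.
rewrite sorted_lt_nth ?se //; last first.
  by apply: sort_sorted => a b; rewrite /= le_total.
rewrite (permP (permEl (perm_sort _ _))) count_map; congr (_ < _)%N.
rewrite cardE /enum_mem size_filter count_filter.
by apply: eq_count => j /=; rewrite finset.in_set andbT.
Qed.

(** Max-min half of Courant-Fischer.  If at most [i] eigenvalues of [W W^*]
    exceeded [z^2], the range of [B], of dimension [N > i], would contain a
    nonzero vector orthogonal to their eigenvectors, on which [W^*] stretches by
    at most [z]. *)
Lemma sigma_gt N (B : 'M[C]_(p, N)) z i : 0 <= z -> (i < N)%N ->
  (forall t, t != 0 ->
     z ^+ 2 * cdot (B *m t) (B *m t) < cdot (W ^t* *m (B *m t)) (W ^t* *m (B *m t))) ->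
  z < sigma W i.
Proof.
move=> z0 iN HB; rewrite lt_sigma // ltnNge; apply/negP => Si.
pose Z : 'M[C]_((#|top z|), N) := rowsub enum_val (Q *m B).
have [|t t0 Zt] := kernel_vector (A := Z).
  by rewrite (leq_ltn_trans (rank_leq_row _)) // (leq_ltn_trans Si).
have := HB t t0; rewrite ltNge => /negP; apply.
rewrite cdot_lam cdot_sqn mulr_sumr ler_sum // => j _.
have [jS|jS] := boolP (j \in top z); last first.
  rewrite finset.in_set in jS.
  by rewrite ler_wpM2r ?addr_ge0 ?sqr_ge0// leNgt.
suff -> : (Q *m (B *m t)) j 0 = 0 by rewrite /sqn /= expr0n /= addr0 !mulr0.
move/colP/(_ (enum_rank_in jS j)): Zt.
by rewrite /Z mul_rowsub_mx [LHS]mxE [RHS]mxE enum_rankK_in// mulmxA.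
Qed.

(** Min-max half.  If more than [i] eigenvalues exceeded [z^2], the span of
    their eigenvectors would meet the kernel of [L], which has codimension at
    most [i], in a nonzero vector. *)
Lemma sigma_le l (L : 'M[C]_(l, p)) z i : 0 <= z -> (\rank L <= i)%N ->
  (forall x, L *m x = 0 -> cdot (W ^t* *m x) (W ^t* *m x) <= z ^+ 2 * cdot x x) ->
  sigma W i <= z.
Proof.
move=> z0 Li HL; rewrite leNgt lt_sigma//.
set T := top z; apply/negP => iS.
pose E : 'M[C]_(p, (#|T|)) := colsub enum_val 1%:M.
have [|t t0 Lt] := kernel_vector (A := L *m (Q ^t* *m E)).
  by rewrite (leq_ltn_trans (mxrankM_maxl _ _)) // (leq_ltn_trans Li).
have Et k : (E *m t) (enum_val k) 0 = t k 0.
  rewrite mxE (bigD1 k)//= big1 ?addr0; last first.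
    by move=> k' kk'; rewrite !mxE (inj_eq enum_val_inj) eq_sym (negbTE kk') mul0r.
  by rewrite !mxE eqxx mul1r.
have Et0 j : j \notin T -> (E *m t) j 0 = 0.
  move=> jS; rewrite mxE big1// => k _; rewrite !mxE.
  case: eqP => [jk|_]; last by rewrite mul0r.
  by move: jS; rewrite jk enum_valP.
have := HL (Q ^t* *m (E *m t)); rewrite -!mulmxA in Lt; rewrite Lt => /(_ erefl).
rewrite cdot_lam cdot_sqn adjQr leNgt => /negP; apply.
rewrite mulr_sumr.
have tpos : exists k, t k 0 != 0.
  apply/existsP; apply: contraNT t0 => /existsPn H; apply/eqP/colP => k.
  by rewrite mxE; apply/eqP; have := H k; rewrite negbK.
case: tpos => k tk.
rewrite (bigD1 (enum_val k))//= [ltRHS](bigD1 (enum_val k))//=.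
apply: ltr_leD.
  have := enum_valP k; rewrite finset.in_set => lk; rewrite ltr_pM2r// Et /sqn.
  rewrite lt_def addr_ge0 ?sqr_ge0// andbT; apply: contraNneq tk => /eqP.
  rewrite paddr_eq0 ?sqr_ge0// !sqrf_eq0 => /andP[/eqP a /eqP b].
  by rewrite eq_complex a b !eqxx.
apply: ler_sum => j _; have [jS|jS] := boolP (j \in T).
  by move: jS; rewrite finset.in_set => jS; rewrite ler_wpM2r ?addr_ge0 ?sqr_ge0// ltW.
by rewrite Et0// /sqn /= expr0n /= addr0 !mulr0.
Qed.

End CourantFischer.

(** * Perturbation of the linearization *)

Section Linearization.
Context {R : realType}.
Local Notation C := R[i].

(** Completing the square: the form of [H] is nonnegative at [v - H^-1 E a].
    Optimizing over [a] gives [H >= E B^-1 E^*] for each positive definite [B]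
    above [E^* H^-1 E]. *)
Lemma compressed_form_le n k (H : 'M[C]_n) (E : 'M[C]_(n, k)) v a :
  H ^t* = H -> H \in unitmx -> (forall x, 0 <= cdot x (H *m x)) ->
  2 * cdot (E ^t* *m v) a - cdot a (E ^t* *m invmx H *m E *m a) <=
  cdot v (H *m v).
Proof.
move=> Hadj Hu Hge0; set w := invmx H *m (E *m a).
have Hw : H *m w = E *m a by rewrite mulmxA mulmxV// mul1mx.
have -> : E ^t* *m invmx H *m E *m a = E ^t* *m w by rewrite -!mulmxA.
have wHv : cdot w (H *m v) = cdot v (E *m a) by rewrite cdot_adjr Hadj Hw cdotC.
rewrite -cdot_adjr cdot_adjl (cdotC (E *m a)).
by have := Hge0 (v - w); rewrite mulmxBr Hw cdotBl !cdotBr wHv; lra.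
Qed.

Section Fixed.
Context {F : base_field} {p q : nat}.
Variables (X P : 'M[C]_(p, q)) (S : thin_svd F P) (z : R).
Hypotheses (z0 : 0 < z) (Xz : opnorm X < z).

Let H := (z%:C)%:M - linearization X.
Let G := compressed_resolvent X S z%:C.
Let W := X + P.
Let theta j := svd_theta S 0 j.

Lemma adj_linearization : (linearization X) ^t* = linearization X.
Proof.
by rewrite /linearization tr_block_mx map_block_mx !trmx0 !map_mx0 trmxCK.
Qed.

Lemma adj_shifted_linearization : H ^t* = H.
Proof.
rewrite /H linearB/= map_mxB /= adj_linearization tr_scalar_mx map_scalar_mx.
by congr (_%:M - _); exact: conjc_real.
Qed.

Lemma shifted_linearization_form x y : cdot (col_mx x y) (H *m col_mx x y) =
  z * (cdot x x + cdot y y) - 2 * cdot x (X *m y).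
Proof.
rewrite /H mulmxBl mul_scalar_mx cdotBr cdotZr /linearization mul_block_col.
rewrite !mul0mx add0r addr0 !cdot_col_mx cdot_adjl.
by rewrite (cdotC (X *m y) x); ring.
Qed.

Lemma shifted_linearization_gt0 v : v != 0 -> 0 < cdot v (H *m v).
Proof.
rewrite -[v]vsubmxK; move: (usubmx v) (dsubmx v) => x y.
rewrite -cdot_gt0 cdot_col_mx shifted_linearization_form => xy.
have h1 : cdot x (X *m y) <= opnorm X * (enorm x * enorm y).
  by apply: (le_trans (cdot_le_enorm _ _)); rewrite mulrCA ler_wpM2l ?enorm_ge0 ?enorm_mulmx_le.
have o0 := opnorm_ge0 X.
have h2 : 2 * (enorm x * enorm y) <= cdot x x + cdot y y.
  by rewrite -!enorm_sqr; have := sqr_ge0 (enorm x - enorm y); lra.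
have h3 : opnorm X * (2 * (enorm x * enorm y)) <= opnorm X * (cdot x x + cdot y y).
  by rewrite ler_wpM2l.
have h4 : opnorm X * (cdot x x + cdot y y) < z * (cdot x x + cdot y y).
  by rewrite ltr_pM2r.
by lra.
Qed.

Lemma shifted_linearization_unit : H \in unitmx.
Proof. exact: posdef_unitmx shifted_linearization_gt0. Qed.

Let H_ge0 v : 0 <= cdot v (H *m v).
Proof.
by have [->|/shifted_linearization_gt0/ltW//] := eqVneq v 0; rewrite cdot0l.
Qed.

Let form_le v a :
  2 * cdot ((frame S) ^t* *m v) a - cdot a (G *m a) <= cdot v (H *m v).
Proof.
by apply: compressed_form_le; rewrite ?adj_shifted_linearization
  ?shifted_linearization_unit.
Qed.

Lemma adj_frame_col (x : 'cV[C]_p) (y : 'cV[C]_q) : (frame S) ^t* *m col_mx x y =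
  col_mx ((svd_U S) ^t* *m x) ((svd_V S) ^t* *m y).
Proof.
rewrite /frame tr_block_mx map_block_mx !trmx0 !map_mx0 mul_block_col.
by rewrite !mul0mx addr0 add0r.
Qed.

Lemma cdot_rdiag r (t : 'rV[R]_r) (u w : 'cV[C]_r) :
  cdot u (rdiag t *m w) =
  \sum_j t 0 j * (complex.Re (u j 0) * complex.Re (w j 0) +
                  complex.Im (u j 0) * complex.Im (w j 0)).
Proof.
rewrite cdotE; apply: eq_bigr => j _; rewrite /rdiag mul_diag_mx !mxE.
by case: (u j 0) (w j 0) => a b [c d] /=; ring.
Qed.

Lemma cdot_spikes (x : 'cV[C]_p) (y : 'cV[C]_q) : cdot x (P *m y) =
  cdot ((svd_U S) ^t* *m x) (rdiag (svd_theta S) *m ((svd_V S) ^t* *m y)).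
Proof. by rewrite {1}(svd_eq S) -!mulmxA cdot_adjr. Qed.

(** Nonnegativity of the form with matrix [(1/s, -th; -th, 1/t)], whose
    determinant has the sign of [1 - th^2 s t]. *)
Lemma spike_form_bound (s t th a b : R) : 0 < s -> 0 < t ->
  th ^+ 2 * (s * t) <= 1 -> 2 * (th * (a * b)) <= s^-1 * a ^+ 2 + t^-1 * b ^+ 2.
Proof.
move=> s0 t0 h.
have h1 : 0 <= s * (s^-1 * a - th * b) ^+ 2 by rewrite mulr_ge0 ?sqr_ge0// ltW.
have h2 : th ^+ 2 * s <= t^-1.
  by rewrite -(ler_pM2r t0) mulVf ?gt_eqF// -mulrA.
have h3 : th ^+ 2 * s * b ^+ 2 <= t^-1 * b ^+ 2 by rewrite ler_wpM2r ?sqr_ge0.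
have h4 : s * (s^-1 * a - th * b) ^+ 2 =
   s^-1 * a ^+ 2 - 2 * (th * (a * b)) + th ^+ 2 * s * b ^+ 2.
  by field; rewrite gt_eqF.
by lra.
Qed.

(** An upper bound [diag(s, t)] on the compressed resolvent bounds the
    singular values: [H >= E diag(s, t)^-1 E^*], and the pairs of spike
    directions with [theta^2 s t <= 1] cannot make [H - E K E^*] negative.  The
    others are disposed of by the conditions [(U^* x)_j = 0] for [j < N], one
    for each spike: the contribution of a spike to the form is bilinear in its
    two coordinates, and vanishes with either of them. *)
Lemma sigma_perturbed_le (s t : R) N : 0 < s -> 0 < t ->
  (forall a b, cdot (col_mx a b) (G *m col_mx a b) <=
               s * cdot a a + t * cdot b b) ->
  (forall j : 'I_(\rank P), (N <= j)%N -> theta j ^+ 2 * (s * t) <= 1) ->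
  sigma W N <= z.
Proof.
move=> s0 t0 HG Hth.
apply: (@sigma_le _ _ _ _ _ (pid_mx N *m (svd_U S) ^t* : 'M[C]_(\rank P, p))).
- exact: ltW.
- apply: (leq_trans (mxrankM_maxl _ _)).
  have [Nr|rN] := leqP N (\rank P); first by rewrite rank_pid_mx.
  by rewrite (leq_trans (rank_leq_row _)) // ltnW.
move=> x; rewrite -mulmxA => Ux.
set u := (svd_U S) ^t* *m x in Ux.
have uj (j : 'I_(\rank P)) : (j < N)%N -> u j 0 = 0.
  move=> jN; move/colP/(_ j): Ux; rewrite mxE (bigD1 j)//= big1 ?addr0.
    by rewrite !mxE eqxx jN /= mul1r.
  by move=> k kj; rewrite !mxE eq_sym (inj_eq val_inj) (negbTE kj) mul0r.
(* The form of [z - lin W] is nonnegative at [(x, y)]; the test vector [a] is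
   [diag(s, t)^-1 (u, w)]. *)
have key y : 2 * cdot x (W *m y) <= z * (cdot x x + cdot y y).
  set w := (svd_V S) ^t* *m y.
  have := form_le (col_mx x y) (col_mx (s^-1%:C *: u) (t^-1%:C *: w)).
  rewrite adj_frame_col -/u -/w shifted_linearization_form cdot_col_mx => h1.
  have := HG (s^-1%:C *: u) (t^-1%:C *: w).
  move: h1; rewrite !cdotZr !cdotZl.
  have -> : s * (s^-1 * (s^-1 * cdot u u)) = s^-1 * cdot u u.
    by rewrite mulVKf ?gt_eqF.
  have -> : t * (t^-1 * (t^-1 * cdot w w)) = t^-1 * cdot w w.
    by rewrite mulVKf ?gt_eqF.
  have : 2 * cdot u (rdiag (svd_theta S) *m w) <= s^-1 * cdot u u + t^-1 * cdot w w.
    rewrite cdot_rdiag !cdotE !mulr_sumr -big_split /= ler_sum // => j _.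
    have [jN|Nj] := ltnP j N.
      rewrite uj //= !mul0r addr0 !mulr0 add0r mulr_ge0 ?invr_ge0 ?(ltW t0)//.
      by rewrite -!expr2 addr_ge0 ?sqr_ge0.
    have Hj := Hth j Nj.
    have := spike_form_bound (complex.Re (u j 0)) (complex.Re (w j 0)) s0 t0 Hj.
    have := spike_form_bound (complex.Im (u j 0)) (complex.Im (w j 0)) s0 t0 Hj.
    by rewrite /theta !expr2; lra.
  rewrite -cdot_spikes /W mulmxDl cdotDr.
  by lra.
(* The minimizer over [y] of the form of [z - lin W] at [(x, y)]. *)
have := key (z^-1%:C *: (W ^t* *m x)).
rewrite -scalemxAr !cdotZr !cdotZl (cdot_adjr W).
set k := cdot _ _ => h.
have : z * (2 * (z^-1 * k)) <= z * (z * (cdot x x + z^-1 * (z^-1 * k))).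
  by rewrite ler_pM2l.
have -> : z * (2 * (z^-1 * k)) = 2 * k by field; rewrite gt_eqF.
have -> : z * (z * (cdot x x + z^-1 * (z^-1 * k))) = z ^+ 2 * cdot x x + k.
  by field; rewrite gt_eqF.
by lra.
Qed.

(** Conversely, a lower bound [diag(s, t)] on the compressed resolvent makes
    [H - E K E^*] negative on the vectors [H^-1 E G^-1 (sqrt s tau, sqrt t tau)]
    with [tau] supported on the spikes up to [i].  There the form
    of [H] is that of [G^-1] at [(sqrt s tau, sqrt t tau)], hence at most that of
    [diag(s, t)^-1], which is [2 |tau|^2]; the spikes contribute
    [2 sqrt(s t) <tau, Theta tau>], which is larger. *)
Lemma sigma_perturbed_gt (s t : R) (i : 'I_(\rank P)) : 0 < s -> 0 < t ->
  (forall a b, s * cdot a a + t * cdot b b <=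
               cdot (col_mx a b) (G *m col_mx a b)) ->
  (forall j : 'I_(\rank P), (j <= i)%N -> 1 < theta j ^+ 2 * (s * t)) ->
  z < sigma W i.
Proof.
move=> s0 t0 HG Hth.
have Gu : G \in unitmx.
  apply: posdef_unitmx => v; rewrite -[v]vsubmxK.
  move: (usubmx v) (dsubmx v) => a b ab; apply: lt_le_trans (HG _ _).
  move: ab; rewrite -cdot_gt0 cdot_col_mx.
  have := cdot_ge0 a; have := cdot_ge0 b; rewrite !le_eqVlt.
  case/predU1P => [<-|b0]; case/predU1P => [<-|a0]; rewrite ?mulr0 ?addr0 ?add0r.
  - by rewrite ltxx.
  - by move=> _; rewrite mulr_gt0.
  - by move=> _; rewrite mulr_gt0.
  - by move=> _; rewrite addr_gt0 ?mulr_gt0.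
pose J : 'M[C]_(\rank P, i.+1) := pid_mx i.+1.
pose T := col_mx ((Num.sqrt s)%:C *: J) ((Num.sqrt t)%:C *: J).
pose B := usubmx (invmx H *m frame S *m invmx G *m T).
apply: (@sigma_gt _ _ _ _ _ B); rewrite ?ltW// => tau tau0.
set sg := J *m tau.
have sgj (j : 'I_(\rank P)) (k : 'I_i.+1) : j = k :> nat -> sg j 0 = tau k 0.
  move=> jk; rewrite mxE (bigD1 k)//= big1 ?addr0.
    by rewrite !mxE jk eqxx ltn_ord mul1r.
  by move=> l lk; rewrite !mxE jk eq_sym (inj_eq val_inj) (negbTE lk) mul0r.
have sgj0 (j : 'I_(\rank P)) : (i < j)%N -> sg j 0 = 0.
  by move=> ij; rewrite mxE big1// => k _; rewrite !mxE ltnS [(j <= i)%N]leqNgt ij andbF mul0r.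
have sg0 : sg != 0.
  apply: contraNneq tau0 => sg0; apply/eqP/colP => k.
  have ki : (k < \rank P)%N by rewrite (leq_trans (ltn_ord k)).
  by rewrite -(sgj (Ordinal ki))// sg0 !mxE.
set u := (Num.sqrt s)%:C *: sg; set w := (Num.sqrt t)%:C *: sg.
have Ttau : T *m tau = col_mx u w by rewrite /T mul_col_mx -!scalemxAl.
set a := invmx G *m col_mx u w.
have Ga : G *m a = col_mx u w by rewrite mulmxA mulmxV// mul1mx.
set v := invmx H *m (frame S *m a).
have Hv : H *m v = frame S *m a by rewrite mulmxA mulmxV ?mul1mx ?shifted_linearization_unit.
have Ev : (frame S) ^t* *m v = col_mx u w.
  by rewrite -Ga /G /compressed_resolvent -!mulmxA.
set x := usubmx v; set y := dsubmx v.
have vE : v = col_mx x y by rewrite vsubmxK.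
have Btau : B *m tau = x.
  by rewrite /x /v /a -Ttau /B mul_usub_mx -!mulmxA.
have ss : Num.sqrt s * Num.sqrt s = s by rewrite -expr2 sqr_sqrtr// ltW.
have tt : Num.sqrt t * Num.sqrt t = t by rewrite -expr2 sqr_sqrtr// ltW.
(* The two uses of [cdot_amgm] amount to [G^-1 <= diag(s, t)^-1]. *)
have formv : cdot v (H *m v) <= 2 * cdot sg sg.
  rewrite Hv cdot_adjr Ev.
  set a1 := usubmx a; set a2 := dsubmx a.
  have aE : a = col_mx a1 a2 by rewrite vsubmxK.
  have auw : cdot (col_mx u w) a = cdot a1 u + cdot a2 w.
    by rewrite cdotC aE cdot_col_mx.
  have := HG a1 a2; rewrite -aE Ga cdotC auw.
  have := cdot_amgm a1 u s0; have := cdot_amgm a2 w t0.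
  have -> : s^-1 * cdot u u = cdot sg sg.
    by rewrite cdotZl cdotZr (mulrA (Num.sqrt s)) ss mulrA mulVf ?gt_eqF ?mul1r.
  have -> : t^-1 * cdot w w = cdot sg sg.
    by rewrite cdotZl cdotZr (mulrA (Num.sqrt t)) tt mulrA mulVf ?gt_eqF ?mul1r.
  by lra.
have spikev : 2 * cdot sg sg < 2 * cdot x (P *m y).
  rewrite ltr_pM2l// cdot_spikes.
  move: Ev; rewrite vE adj_frame_col => /eq_col_mx[-> ->].
  have st1 (j : 'I_(\rank P)) : (j <= i)%N -> 1 < theta j * (Num.sqrt s * Num.sqrt t).
    move=> ji; rewrite -[ltLHS]sqrtr1 -sqrtrM ?ltW//.
    have th0 : 0 < theta j by apply: svd_theta_gt0.
    rewrite -[theta j]gtr0_norm// -sqrtr_sqr -sqrtrM ?sqr_ge0//.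
    by rewrite ltr_sqrt ?Hth// (lt_trans ltr01) ?Hth.
  rewrite cdot_rdiag cdotE.
  have E (j : 'I_(\rank P)) : svd_theta S 0 j *
     (complex.Re (u j 0) * complex.Re (w j 0) + complex.Im (u j 0) * complex.Im (w j 0)) =
     theta j * (Num.sqrt s * Num.sqrt t) * (complex.Re (sg j 0) * complex.Re (sg j 0) +
       complex.Im (sg j 0) * complex.Im (sg j 0)).
    rewrite /u /w /theta ![(_ *: sg) j 0]mxE.
    by case: (sg j 0) => c d /=; ring.
  rewrite (eq_bigr _ (fun j _ => E j)).
  have pos (j : 'I_(\rank P)) : 0 <= complex.Re (sg j 0) * complex.Re (sg j 0) +
       complex.Im (sg j 0) * complex.Im (sg j 0).
    by rewrite -!expr2 addr_ge0 ?sqr_ge0.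
  have [j sj] : exists j, sg j 0 != 0.
    apply/existsP; apply: contraNT sg0 => /existsPn h; apply/eqP/colP => k.
    by rewrite [RHS]mxE; apply/eqP; have := h k; rewrite negbK.
  have ji : (j <= i)%N by rewrite leqNgt; apply: contraNN sj => /sgj0 ->.
  rewrite (bigD1 j)//= [ltRHS](bigD1 j)//=; apply: ltr_leD.
    rewrite ltr_pMl ?st1// lt_def pos andbT; apply: contraNneq sj => /eqP.
    rewrite -!expr2 paddr_eq0 ?sqr_ge0// !sqrf_eq0 => /andP[/eqP e /eqP f].
    by rewrite eq_complex e f !eqxx.
  apply: ler_sum => k _; have [ki|ik] := leqP k i.
    by rewrite ler_peMl// ltW// st1.
  by rewrite sgj0//= !mulr0 addr0 mulr0.
rewrite Btau.
have h1 : z * (cdot x x + cdot y y) < 2 * cdot x (W *m y).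
  rewrite /W mulmxDl cdotDr.
  by move: formv; rewrite vE shifted_linearization_form; lra.
rewrite (cdot_adjr W) in h1.
have := cdot_amgm y (W ^t* *m x) z0; rewrite (cdotC y) => h2.
set k := cdot (W ^t* *m x) (W ^t* *m x) in h2 *.
have : z * (z * cdot x x) < z * (z^-1 * k) by rewrite ltr_pM2l//; lra.
by rewrite !mulrA mulfV ?gt_eqF// mul1r expr2.
Qed.

End Fixed.

Lemma opnorm_form_le r (G : 'M[C]_(r + r)) (f g e : R) a b :
  opnorm (G - block_mx (f%:C)%:M 0 0 (g%:C)%:M) <= e ->
  (f - e) * cdot a a + (g - e) * cdot b b <=
    cdot (col_mx a b) (G *m col_mx a b) <=
  (f + e) * cdot a a + (g + e) * cdot b b.
Proof.
set D := _ - _ => He; set v := col_mx a b.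
have GE : cdot v (G *m v) = cdot v (D *m v) + (f * cdot a a + g * cdot b b).
  rewrite /D mulmxBl cdotBr mul_block_col !mul0mx addr0 add0r !mul_scalar_mx.
  by rewrite [X in _ = _ - X + _]cdot_col_mx !cdotZr; ring.
have vv : cdot v v = cdot a a + cdot b b by rewrite cdot_col_mx.
have h : enorm v * enorm (D *m v) <= e * cdot v v.
  rewrite -enorm_sqr expr2 mulrA [leRHS]mulrC ler_wpM2l ?enorm_ge0//.
  by apply: (le_trans (enorm_mulmx_le _ _)); rewrite ler_wpM2r ?enorm_ge0.
have := cdot_le_enorm v (D *m v); have := cdot_geN_enorm v (D *m v).
by rewrite GE; move: h; rewrite vv => *; apply/andP; split; lra.
Qed.

End Linearization.

(** * The transforms on the real axis *)

Lemma measurable_inv (R : realType) : measurable_fun [set: R] (fun x : R => x^-1).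
Proof.
rewrite (_ : [set: R] = [set 0] `|` ~` [set 0]); last by rewrite setUv.
apply/measurable_funU => //; first exact: measurableC.
split; first exact: measurable_fun_set1.
apply: open_continuous_measurable_fun.
  by rewrite openC; apply: accessible_closed_set1; apply: hausdorff_accessible; exact: Rhausdorff.
by move=> x; rewrite inE /= => /eqP x0; apply: inv_continuous.
Qed.

Section Support.
Context {R : realType} (mu : probability (measurableTypeR R) R).
Local Notation b := (edge mu).

(** Off the support every point has a rational null neighbourhood, and there
    are countably many of those. *)
Lemma mu_gt_sup_supp : compact (supp mu) -> mu `]sup (supp mu), +oo[%classic = 0%E.
Proof.
move=> cpt.
pose N (k : nat) : set R := if unpickle k is Some (q1, q2) then
   if mu `]ratr q1 : R, ratr q2[%classic == 0%E then `]ratr q1 : R, ratr q2[%classic else set0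
   else set0.
have hN : mu.-negligible (\bigcup_k N k : set (measurableTypeR R)).
  apply: negligible_bigcup => k; rewrite /N.
  case: unpickle => [[q1 q2]|]; last exact: negligible_set0.
  case: ifPn => [/eqP h|_]; last exact: negligible_set0.
  by apply/negligibleP => //; exact: measurable_itv.
apply/negligibleP; first exact: measurable_itv.
apply: negligibleS hN => x; rewrite /= in_itv /= andbT => Sx.
have : ~ supp mu x.
  move=> sx; move: Sx; apply/negP; rewrite -leNgt; apply: ub_le_sup => //.
  have [M [_ HM]] := compact_bounded cpt.
  exists (`|M| + 1) => y sy; apply: (le_trans (ler_norm y)).
  by apply: HM => //; rewrite ltr_pwDr// ler_norm.
move=> /existsNP[e /not_implyP[e0 /negP]]; rewrite -leNgt => mue.
have /rat_in_itvoo[q1] : x - e < x by rewrite ltrBlDr ltrDl.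
rewrite in_itv /= => /andP[q1l q1r].
have /rat_in_itvoo[q2] : x < x + e by rewrite ltrDl.
rewrite in_itv /= => /andP[q2l q2r].
exists (pickle (q1, q2)); first exact: I.
rewrite /N pickleK.
rewrite ifT /= ?in_itv /= ?q1r ?q2l//.
rewrite -measure_le0; apply: le_trans mue; apply: le_measure; rewrite ?inE.
- exact: measurable_itv.
- exact: (measurable_ball x).
- move=> y /=; rewrite in_itv /= => /andP[y1 y2].
  by rewrite /ball /= ltr_distlC; apply/andP; split; [apply: lt_trans q1l y1|apply: lt_trans y2 q2r].
Qed.

Hypothesis mu_ge0 : mu `[0, +oo[%classic = 1%E.
Hypothesis mu_cpt : compact (supp mu).

Lemma edge_ge0 : 0 <= b. Proof. exact: sqrtr_ge0. Qed.

Lemma ae_mu : {ae mu, forall x, 0 <= x <= b ^+ 2}.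
Proof.
have h1 : mu.-negligible (~` `[0%R : R, +oo[%classic).
  apply/negligibleP; first by apply: measurableC; exact: measurable_itv.
  apply: eq_trans (probability_setC mu (measurable_itv _)) _.
  by rewrite mu_ge0 subee.
have h2 : mu.-negligible `]sup (supp mu), +oo[%classic.
  by apply/negligibleP; [exact: measurable_itv|exact: mu_gt_sup_supp].
apply: negligibleS (negligibleU h1 h2) => x /= /negP.
rewrite negb_and -!ltNge => /orP[x0|bx].
  by left; rewrite /= in_itv /= andbT leNgt x0.
right; rewrite /= in_itv /= andbT; apply: le_lt_trans bx.
rewrite /edge; have [s0|s0] := leP 0 (sup (supp mu)); first by rewrite sqr_sqrtr.
by rewrite (le_trans (ltW s0)) ?sqr_ge0.
Qed.

(** The integrand of [phi] at a real point, with [x] clamped to [[0, b^2]]: this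
    changes it on a null set only, and makes it continuous and the pointwise
    bounds valid everywhere. *)
Definition phi_integrand (z x : R) : R := z / (z ^+ 2 - Num.min (Num.max x 0) (b ^+ 2)).

Definition phir (z : R) : R := \int[mu]_x phi_integrand z x.

Let clampP x : 0 <= Num.min (Num.max x 0) (b ^+ 2) <= b ^+ 2.
Proof. by rewrite le_min le_max lexx orbT sqr_ge0 /= ge_min lexx orbT. Qed.

Let Rintegral_cst1 (k : R) : \int[mu]_x k = k.
Proof.
rewrite Rintegral_cst//; transitivity (k * fine (1%E : \bar R)).
  by congr (_ * fine _); exact: probability_setT.
by rewrite mulr1.
Qed.

Let sqr_gt z : b < z -> b ^+ 2 < z ^+ 2.
Proof. by move=> bz; rewrite ltrXn2r// ?edge_ge0// (le_trans edge_ge0 (ltW bz)). Qed.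

Let gt0 z : b < z -> 0 < z. Proof. exact/le_lt_trans/edge_ge0. Qed.

Lemma phi_integrand_bounds z x : b < z -> z^-1 <= phi_integrand z x <= z / (z ^+ 2 - b ^+ 2).
Proof.
move=> bz; have /andP[k0 kb] := clampP x; have bz2 := sqr_gt bz; have z0 := gt0 bz.
rewrite /phi_integrand; move: (Num.min _ _) k0 kb => k k0 kb.
have zk : 0 < z ^+ 2 - k by rewrite subr_gt0 (le_lt_trans kb).
apply/andP; split.
  rewrite ler_pdivlMr// mulrBr expr2 mulrA mulVf ?gt_eqF// mul1r.
  by rewrite lerBlDr lerDl mulr_ge0// invr_ge0 ltW.
rewrite ler_pM2l// lef_pV2 ?posrE// ?lerD2l ?lerN2//.
by rewrite subr_gt0.
Qed.

(** The difference is [(z - y) (y z + x) / ((y^2 - x) (z^2 - x))]: the lower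
    bound is its value at [x = 0], where it is smallest. *)
Lemma phi_integrand_decrease y z x : b < y -> y <= z ->
  y^-1 - z^-1 <= phi_integrand y x - phi_integrand z x <=
  (y * z + b ^+ 2) / (y ^+ 2 - b ^+ 2) ^+ 2 * (z - y).
Proof.
move=> by_ yz; have /andP[k0 kb] := clampP x; have by2 := sqr_gt by_.
have y0 := gt0 by_; have z0 := lt_le_trans y0 yz.
rewrite /phi_integrand; move: (Num.min _ _) k0 kb => k k0 kb.
have yk : 0 < y ^+ 2 - k by rewrite subr_gt0 (le_lt_trans kb).
have yz2 : y ^+ 2 <= z ^+ 2 by rewrite lerXn2r// ?nnegrE ltW.
have zk : 0 < z ^+ 2 - k by rewrite subr_gt0 (le_lt_trans kb)// (lt_le_trans by2).
have yb : 0 < y ^+ 2 - b ^+ 2 by rewrite subr_gt0.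
have -> : y / (y ^+ 2 - k) - z / (z ^+ 2 - k) =
    (z - y) * ((y * z + k) / ((y ^+ 2 - k) * (z ^+ 2 - k))).
  by field; rewrite !gt_eqF.
have -> : y^-1 - z^-1 = (z - y) * (y * z)^-1 by field; rewrite !gt_eqF.
apply/andP; split; last rewrite [leRHS]mulrC; apply: ler_wpM2l; rewrite ?subr_ge0//.
  rewrite ler_pdivlMr ?mulr_gt0// mulrC ler_pdivrMr ?mulr_gt0//.
  have -> : (y * z + k) * (y * z) = (y ^+ 2 - k) * (z ^+ 2 - k) +
     k * (y * z + y ^+ 2 + (z ^+ 2 - k)) by ring.
  by rewrite lerDl mulr_ge0// addr_ge0 ?(ltW zk)// addr_ge0 ?sqr_ge0// mulr_ge0// ltW.
apply: ler_pM.
- by rewrite addr_ge0// mulr_ge0// ltW.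
- by rewrite invr_ge0 mulr_ge0// ltW.
- by rewrite lerD2l.
rewrite lef_pV2 ?posrE ?mulr_gt0// expr2; apply: ler_pM; rewrite ?(ltW yb)//.
  by rewrite lerD2l lerN2.
by apply: lerB.
Qed.

Let continuous_phi_integrand z : b < z -> continuous (phi_integrand z).
Proof.
move=> bz x; have /andP[k0 kb] := clampP x.
apply: cvgM; first exact: cvg_cst.
apply: cvgV.
  by rewrite gt_eqF// subr_gt0 (le_lt_trans kb)// sqr_gt.
apply: cvgB; first exact: cvg_cst.
apply: (@continuous_min _ R (fun x => Num.max x 0) (fun=> b ^+ 2)); last exact: cvg_cst.
by apply: (@continuous_max _ R id (fun=> 0)); [exact: cvg_id|exact: cvg_cst].
Qed.

Lemma integrable_phi_integrand z : b < z -> mu.-integrable setT (EFin \o phi_integrand z).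
Proof.
move=> bz; apply: measurable_bounded_integrable => //.
- by apply: (le_lt_trans (probability_le1 mu measurableT)); exact: ltry.
- exact: (continuous_measurable_fun (continuous_phi_integrand bz)).
- exists (z / (z ^+ 2 - b ^+ 2)); split; first exact: num_real.
  move=> M zM x _; have /andP[l u] := phi_integrand_bounds x bz.
  rewrite /= ger0_norm; first exact: (le_trans u (ltW zM)).
  by apply: le_trans l; rewrite invr_ge0 ltW// gt0.
Qed.

Lemma phi_real z : b < z -> phi mu z%:C = (phir z)%:C.
Proof.
move=> bz.
have fE x : z%:C / (z%:C ^+ 2 - x%:C) = (z / (z ^+ 2 - x))%:C.
  by rewrite rmorphM fmorphV rmorphB rmorphXn.
rewrite /phi /phir.
under eq_Rintegral do rewrite fE /=.
under [X in _ +i* X]eq_Rintegral do rewrite fE /=.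
congr (_ +i* _); last by rewrite /Rintegral integral0.
rewrite /Rintegral; congr fine; apply: ae_eq_integral => //.
- apply/measurable_EFinP; apply: measurable_funM => //.
  apply: (measurableT_comp (@measurable_inv R)).
  by apply: measurable_funB.
- by apply/measurable_EFinP; exact: (continuous_measurable_fun (continuous_phi_integrand bz)).
- apply: negligibleS ae_mu => x /= h h'; apply: h => _; congr EFin.
  case/andP: h' => x0 xb.
  by rewrite /phi_integrand (max_l x0) (min_l xb).
Qed.

Lemma phir_bounds z : b < z -> z^-1 <= phir z <= z / (z ^+ 2 - b ^+ 2).
Proof.
move=> bz.
have icst (k : R) : mu.-integrable setT (EFin \o (fun=> k)).
  by apply: finite_measure_integrable_cst.
rewrite -(Rintegral_cst1 z^-1) -(Rintegral_cst1 (z / _)) /phir.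
apply/andP; split; apply: le_Rintegral => //; do ?exact: integrable_phi_integrand;
  by move=> x _; have /andP[] := phi_integrand_bounds x bz.
Qed.

Lemma phir_decrease y z : b < y -> y <= z ->
  y^-1 - z^-1 <= phir y - phir z <=
  (y * z + b ^+ 2) / (y ^+ 2 - b ^+ 2) ^+ 2 * (z - y).
Proof.
move=> by_ yz; have bz := lt_le_trans by_ yz.
have icst (k : R) : mu.-integrable setT (EFin \o (fun=> k)).
  by apply: finite_measure_integrable_cst.
rewrite /phir -RintegralB//; do ?exact: integrable_phi_integrand.
rewrite -(Rintegral_cst1 (_^-1 - _^-1)) -(Rintegral_cst1 (_ * (z - y))).
have iB : mu.-integrable setT (EFin \o (fun x => phi_integrand y x - phi_integrand z x)).
  exact: (integrableB measurableT (integrable_phi_integrand by_) (integrable_phi_integrand bz)).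
apply/andP; split; apply: le_Rintegral => //;
  by move=> x _; have /andP[] := phi_integrand_decrease x by_ yz.
Qed.

Lemma continuous_phir z : b < z -> {for z, continuous phir}.
Proof.
move=> bz; have z0 := gt0 bz.
pose al := (b + z) / 2; have bal : b < al by rewrite /al; lra.
have alz : al < z by rewrite /al; lra.
have al0 := gt0 bal; have al2 := sqr_gt bal.
have ab0 : 0 < al ^+ 2 - b ^+ 2 by rewrite subr_gt0.
pose K := ((z + 1) * (z + 1) + b ^+ 2) / (al ^+ 2 - b ^+ 2) ^+ 2.
have K0 : 0 < K.
  by rewrite divr_gt0 ?exprn_gt0// ltr_pwDl ?sqr_ge0// mulr_gt0// addr_gt0.
have lip u v : al <= u -> u <= v -> v <= z + 1 -> `|phir u - phir v| <= K * (v - u).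
  move=> au uv vz; have bu := lt_le_trans bal au; have u0 := gt0 bu.
  have v0 := lt_le_trans u0 uv.
  have /andP[l h] := phir_decrease bu uv.
  rewrite ger0_norm; last by apply: le_trans l; rewrite subr_ge0 lef_pV2.
  apply: (le_trans h); apply: ler_wpM2r; first by rewrite subr_ge0.
  have ub0 : 0 < u ^+ 2 - b ^+ 2 by rewrite subr_gt0 sqr_gt.
  apply: ler_pM; rewrite ?invr_ge0 ?(addr_ge0 _ (sqr_ge0 _)) ?(mulr_ge0 (ltW u0) (ltW v0)) ?sqr_ge0//.
    rewrite lerD2r; apply: ler_pM; rewrite ?(ltW u0) ?(ltW v0)//; exact: le_trans vz.
  rewrite lef_pV2 ?posrE ?exprn_gt0//; apply: lerXn2r; rewrite ?nnegrE ?(ltW ab0) ?(ltW ub0)//.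
  by rewrite lerD2r; apply: lerXn2r; rewrite ?nnegrE ?(ltW al0) ?(ltW u0).
apply/cvgrPdist_le => /= e e0.
have : \forall t \near z, `|z - t| < Num.min (Num.min (z - al) 1) (e / K).
  apply/nbhs_ballP; exists (Num.min (Num.min (z - al) 1) (e / K)) => //=.
  by rewrite !lt_min subr_gt0 alz ltr01 divr_gt0.
apply: filterS => t; rewrite !lt_min !ltr_distl => /andP[/andP[/andP[t1 t2] /andP[t3 t4]] h].
have {}h : K * `|z - t| <= e by rewrite mulrC -ler_pdivlMr// ltW// ltr_distl.
have [zt|tz] := leP z t.
  apply: le_trans (lip _ _ _ zt _) _; rewrite ?(ltW alz)//; first by lra.
  by move: h; rewrite distrC ger0_norm// subr_ge0.
rewrite distrC; apply: le_trans (lip _ _ _ (ltW tz) _) _; [lra|lra|].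
by move: h; rewrite ger0_norm// subr_ge0 ltW.
Qed.

End Support.

Section Dtransform.
Context {R : realType} (mu : probability (measurableTypeR R) R) (c : R).
Hypothesis mu_ge0 : mu `[0, +oo[%classic = 1%E.
Hypothesis mu_cpt : compact (supp mu).
Hypothesis c01 : 0 < c <= 1.
Local Notation b := (edge mu).
Local Notation phir := (phir mu).

Definition phitr (z : R) : R := c * phir z + (1 - c) / z.

Lemma phit_real z : b < z -> phit mu c z%:C = (phitr z)%:C.
Proof.
by move=> bz; rewrite /phit phi_real// /phitr [RHS]rmorphD /= !rmorphM /= fmorphV.
Qed.

Lemma dreal_phir z : b < z -> dreal mu c z = phir z * phitr z.
Proof. by move=> bz; rewrite /dreal /dtrans phi_real// phit_real// -rmorphM. Qed.

Let gt0 z : b < z -> 0 < z. Proof. exact/le_lt_trans/edge_ge0. Qed.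

Lemma phir_gt0 z : b < z -> 0 < phir z.
Proof.
move=> bz; have /andP[+ _] := phir_bounds bz.
by apply: lt_le_trans; rewrite invr_gt0 gt0.
Qed.

Lemma phitr_gt0 z : b < z -> 0 < phitr z.
Proof.
case/andP: c01 => c0 c1 bz; rewrite /phitr ltr_pwDl ?mulr_gt0 ?phir_gt0//.
by rewrite divr_ge0 ?subr_ge0// ltW// gt0.
Qed.

(** Both transforms decrease at least as fast as [1/z]; hence an additive error
    [e] in them costs a shift of at most [beta^2 e] of their argument. *)
Lemma inv_shift (y z e be : R) : 0 < y -> y <= z -> z <= be -> 0 <= e ->
  be ^+ 2 * e <= z - y -> e <= y^-1 - z^-1.
Proof.
move=> y0 yz zb e0 h; have z0 := lt_le_trans y0 yz.
have -> : y^-1 - z^-1 = (z - y) / (y * z) by field; rewrite !gt_eqF.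
rewrite ler_pdivlMr ?mulr_gt0//; apply: le_trans h; rewrite mulrC ler_wpM2r//.
by rewrite expr2; apply: ler_pM; rewrite ?(ltW y0) ?(ltW z0)// (le_trans yz).
Qed.

Lemma phir_shift y z e be : b < y -> y <= z -> z <= be -> 0 <= e ->
  be ^+ 2 * e <= z - y -> phir z + e <= phir y.
Proof.
move=> by_ yz zb e0 h; have := inv_shift (gt0 by_) yz zb e0 h.
by have /andP[+ _] := phir_decrease by_ yz; lra.
Qed.

Lemma phitr_shift y z e be : b < y -> y <= z -> z <= be -> 0 <= e ->
  be ^+ 2 * e <= z - y -> phitr z + e <= phitr y.
Proof.
case/andP: c01 => c0 c1 by_ yz zb e0 h; have := inv_shift (gt0 by_) yz zb e0 h.
have /andP[+ _] := phir_decrease by_ yz; rewrite /phitr.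
set u := y^-1; set v := z^-1; move=> h1 h2.
have h3 : c * (u - v) <= c * (phir y - phir z) by rewrite ler_wpM2l// ltW.
by lra.
Qed.

(** The shift bounds apply with [e = (z - y) / z^2]. *)
Lemma dreal_lt y z : b < y -> y < z -> dreal mu c z < dreal mu c y.
Proof.
move=> by_ yz; have bz := lt_trans by_ yz; have z0 := gt0 bz.
pose e := (z - y) / z ^+ 2.
have e0 : 0 < e by rewrite divr_gt0 ?exprn_gt0// subr_gt0.
have h : z ^+ 2 * e <= z - y.
  by rewrite /e mulrC divfK// expf_eq0/= gt_eqF.
rewrite !dreal_phir//; apply: ltr_pM; rewrite ?(ltW (phir_gt0 _)) ?(ltW (phitr_gt0 _))//.
- by have := phir_shift by_ (ltW yz) (lexx z) (ltW e0) h; lra.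
- by have := phitr_shift by_ (ltW yz) (lexx z) (ltW e0) h; lra.
Qed.

Lemma dreal_le y z : b < y -> b < z -> dreal mu c y <= dreal mu c z -> z <= y.
Proof. by move=> by_ bz; apply: contraTT; rewrite -!ltNge; exact: dreal_lt. Qed.

Lemma dreal_lt_far y : 0 < y -> exists2 z, b < z & dreal mu c z < y.
Proof.
case/andP: c01 => c0 c1 y0; have b0 := edge_ge0 mu.
pose z := 2 * b + 1 + 4 / y.
have y4 : 0 < 4 / y by rewrite divr_gt0.
have bz : b < z by rewrite /z; lra.
have z1 : 1 <= z by rewrite /z; lra.
have z0 := gt0 bz.
exists z => //.
(* From [z >= 2 b]: then [z / (z^2 - b^2) <= 4 / (3 z)]. *)
have phi2 : phir z <= 2 / z.
  have /andP[_ h] := phir_bounds bz; apply: le_trans h _.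
  have h2 : (2 * b) ^+ 2 <= z ^+ 2 by apply: lerXn2r; rewrite ?nnegrE ?mulr_ge0 ?(ltW z0)// /z; lra.
  have hb : 0 < z ^+ 2 - b ^+ 2.
    by have : 0 < z ^+ 2 by [rewrite exprn_gt0]; move: h2; rewrite exprMn; lra.
  rewrite ler_pdivrMr// mulrAC ler_pdivlMr// -expr2.
  by move: h2; rewrite exprMn; have := sqr_ge0 b; lra.
have phit2 : phitr z <= 2 / z.
  rewrite /phitr; have h : c * phir z <= c * (2 / z) by rewrite ler_wpM2l// ltW.
  have : 0 < z^-1 by rewrite invr_gt0.
  by move: h; set u := z^-1 => h u0; have : 0 <= (1 - c) * u by [rewrite mulr_ge0 ?subr_ge0 ?(ltW u0)]; lra.
rewrite dreal_phir//.
apply: (@le_lt_trans _ _ ((2 / z) * (2 / z))).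
  by apply: ler_pM; rewrite ?(ltW (phir_gt0 _)) ?(ltW (phitr_gt0 _)).
have -> : 2 / z * (2 / z) = 4 / z / z by field; rewrite gt_eqF.
rewrite ltr_pdivrMr//.
apply: (@lt_le_trans _ _ y); last by rewrite ler_peMr// ltW.
rewrite ltr_pdivrMr// mulrC -ltr_pdivrMr// /z; lra.
Qed.

Lemma continuous_dreal z : b < z -> {for z, continuous (fun z => phir z * phitr z)}.
Proof.
move=> bz; have cp := continuous_phir bz.
apply: cvgM; first exact: cp.
apply: cvgD; first by apply: cvgM; [exact: cvg_cst|exact: cp].
by apply: cvgM; [exact: cvg_cst|apply: cvgV; [rewrite gt_eqF ?gt0|exact: cvg_id]].
Qed.

Hypothesis edge_cond : edge_condition mu c.

Lemma dreal_gt_near y : y < d_edge mu c -> exists2 z, b < z & y < dreal mu c z.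
Proof.
case: edge_cond => cv _ yd.
have : \forall z \near b^'+, y < dreal mu c z by exact: (cvgr_gt _ cv).
have : \forall z \near b^'+, b < z by exact: nbhs_right_gt.
move=> h1 h2; have [z [h3 h4]] := filter_ex (filterI h1 h2).
by exists z.
Qed.

Lemma dreal_onto y : 0 < y -> y < d_edge mu c -> exists2 z, b < z & dreal mu c z = y.
Proof.
move=> y0 yd; have [z1 bz1 h1] := dreal_gt_near yd; have [z2 bz2 h2] := dreal_lt_far y0.
have z12 : z1 <= z2.
  by apply: dreal_le => //; apply: ltW; exact: lt_trans h2 h1.
have cf : {within `[z1, z2], continuous (fun z => phir z * phitr z)}.
  apply: continuous_in_subspaceT => x; rewrite inE /= in_itv /= => /andP[x1 _].
  by apply: continuous_dreal; exact: lt_le_trans bz1 x1.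
have [|x] := IVT z12 cf (v := y).
  rewrite -!dreal_phir//; apply/andP; split.
    by rewrite ge_min (ltW h2) orbT.
  by rewrite le_max (ltW h1).
rewrite in_itv /= => /andP[x1 _] xy; have bx := lt_le_trans bz1 x1.
by exists x => //; rewrite dreal_phir.
Qed.

Lemma theta_star_gt0 : 0 < theta_star mu c.
Proof. by case: edge_cond => _ d0; rewrite /theta_star invr_gt0 sqrtr_gt0. Qed.

Lemma rho_spec t : theta_star mu c < t ->
  b < rho mu c t /\ dreal mu c (rho mu c t) = t ^- 2.
Proof.
move=> ts; have s0 := theta_star_gt0; have t0 := lt_trans s0 ts.
have d0 : 0 < d_edge mu c by case: edge_cond.
rewrite /rho ts /dinv.
have [z bz zt] : exists2 z, b < z & dreal mu c z = t ^- 2.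
  apply: dreal_onto; first by rewrite invr_gt0 exprn_gt0.
  have <- : theta_star mu c ^- 2 = d_edge mu c.
    by rewrite /theta_star exprVn invrK sqr_sqrtr// ltW.
  by rewrite ltf_pV2 ?posrE ?exprn_gt0// ltrXn2r// ltW.
by apply: (@xgetPex _ b [set z | b < z /\ dreal mu c z = t ^- 2]); exists z.
Qed.

Lemma rho_le s t : theta_star mu c < s -> s <= t -> rho mu c s <= rho mu c t.
Proof.
move=> ts st; have s0 := lt_trans theta_star_gt0 ts; have t0 := lt_le_trans s0 st.
have [bs ds] := rho_spec ts; have [bt dt] := rho_spec (lt_le_trans ts st).
apply: dreal_le => //; rewrite ds dt lef_pV2 ?posrE ?exprn_gt0//.
by apply: lerXn2r; rewrite // nnegrE ltW.
Qed.

End Dtransform.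

(** * Locating the spikes *)

Section SpikeTracking.
Context {R : realType} (mu : probability (measurableTypeR R) R) (c : R).
Hypothesis mu_ge0 : mu `[0, +oo[%classic = 1%E.
Hypothesis mu_cpt : compact (supp mu).
Hypothesis c01 : 0 < c <= 1.
Hypothesis edge_cond : edge_condition mu c.

Lemma Mlim_real r z : edge mu < z ->
  Mlim mu c r z%:C = block_mx ((phir mu z)%:C)%:M 0 0 ((phitr mu c z)%:C)%:M.
Proof. by move=> bz; rewrite /Mlim (phi_real mu_ge0 mu_cpt bz) (phit_real c mu_ge0 mu_cpt bz). Qed.

Context {F : base_field} {p q : nat}.
Variables (X P : 'M[R[i]]_(p, q)) (S : thin_svd F P) (al be e eta : R).
Hypotheses (al_gt : edge mu < al) (Xal : opnorm X < al).
Hypothesis dev : forall z, al <= z <= be ->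
  opnorm (compressed_resolvent X S z%:C - Mlim mu c _ z%:C) <= e.
Hypotheses (e0 : 0 <= e) (e_eta : be ^+ 2 * e < eta).
Local Notation theta j := (svd_theta S 0 j).

Let dev_form z a b' : al <= z <= be ->
  (phir mu z - e) * cdot a a + (phitr mu c z - e) * cdot b' b' <=
    cdot (col_mx a b') (compressed_resolvent X S z%:C *m col_mx a b') <=
  (phir mu z + e) * cdot a a + (phitr mu c z + e) * cdot b' b'.
Proof.
move=> zI; have := dev zI.
have bz : edge mu < z by case/andP: zI => alz _; exact: lt_le_trans al_gt alz.
rewrite Mlim_real; [exact: opnorm_form_le|exact: bz].
Qed.

Let z_pos z : al <= z -> 0 < z.
Proof. by move=> alz; apply: le_lt_trans (edge_ge0 mu) (lt_le_trans al_gt alz). Qed.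

(** At [z = rho t + eta] the error [e] is absorbed by the displacement:
    [(phi z + e) (phit z + e) <= d (rho t) = t^-2], so that the spikes up to [t]
    do not push a singular value beyond [z]. *)
Lemma sigma_le_rho t N : theta_star mu c < t ->
  al <= rho mu c t -> rho mu c t + eta <= be ->
  (forall j : 'I_(\rank P), (N <= j)%N -> theta j <= t) ->
  sigma (X + P) N <= rho mu c t + eta.
Proof.
move=> ts alr rbe Hth; set z := _ + eta in rbe *.
have [br dr] := rho_spec mu_ge0 mu_cpt c01 edge_cond ts.
have t0 := lt_trans (theta_star_gt0 edge_cond) ts.
have eta0 : 0 < eta by apply: le_lt_trans e_eta; rewrite mulr_ge0 ?sqr_ge0.
have rz : rho mu c t <= z by rewrite lerDl ltW.
have alz := le_trans alr rz; have bz := lt_le_trans al_gt alz.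
have ez : be ^+ 2 * e <= z - rho mu c t by rewrite /z addrC addKr ltW.
have zI : al <= z <= be by rewrite alz.
have s0 : 0 < phir mu z + e by rewrite ltr_wpDr ?phir_gt0.
have t0' : 0 < phitr mu c z + e by rewrite ltr_wpDr ?phitr_gt0.
apply: (@sigma_perturbed_le _ _ _ _ _ _ S _ _ _ (phir mu z + e) (phitr mu c z + e)) => //.
- exact: z_pos.
- exact: lt_le_trans Xal alz.
- by move=> a b'; have /andP[] := dev_form a b' zI.
move=> j Nj; have thj := Hth j Nj.
have st : (phir mu z + e) * (phitr mu c z + e) <= t ^- 2.
  rewrite -dr dreal_phir//; apply: ler_pM; rewrite ?(ltW s0) ?(ltW t0')//.
    exact: (phir_shift br rz rbe).
  exact: (phitr_shift c01 br rz rbe).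
rewrite -(divff (x := t ^+ 2)); last by rewrite expf_eq0 /= gt_eqF.
apply: ler_pM; rewrite ?sqr_ge0 ?mulr_ge0 ?(ltW s0) ?(ltW t0')//.
by apply: lerXn2r; rewrite // nnegrE ltW // ?svd_theta_gt0.
Qed.

(** At [z = rho (theta i) - eta], dually, [(phi z - e) (phit z - e)] exceeds
    [d (rho (theta i)) = (theta i)^-2]; strictly so, because [eta] exceeds
    [be^2 e]. *)
Lemma sigma_gt_rho (i : 'I_(\rank P)) : theta_star mu c < theta i ->
  al <= rho mu c (theta i) - eta -> rho mu c (theta i) <= be ->
  rho mu c (theta i) - eta < sigma (X + P) i.
Proof.
set t := theta i => ts alz rbe; set z := _ - eta in alz *.
have [br dr] := rho_spec mu_ge0 mu_cpt c01 edge_cond ts.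
have t0 := lt_trans (theta_star_gt0 edge_cond) ts.
have eta0 : 0 < eta by apply: le_lt_trans e_eta; rewrite mulr_ge0 ?sqr_ge0.
have rz : z <= rho mu c t by rewrite gerDl oppr_le0 ltW.
have bz := lt_le_trans al_gt alz.
have zI : al <= z <= be by rewrite alz (le_trans rz).
have be0 : 0 < be ^+ 2 by rewrite exprn_gt0// z_pos// (le_trans alz)// (le_trans rz).
have ee : e < eta / be ^+ 2 by rewrite ltr_pdivlMr// mulrC.
have ez : be ^+ 2 * (eta / be ^+ 2) <= rho mu c t - z.
  by rewrite mulrC divfK ?gt_eqF// /z opprB addrC subrK.
have ee0 : 0 <= eta / be ^+ 2 by rewrite (le_trans e0)// ltW.
have s1 : phir mu (rho mu c t) < phir mu z - e.
  by have := phir_shift bz rz rbe ee0 ez; lra.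
have s2 : phitr mu c (rho mu c t) < phitr mu c z - e.
  by have := phitr_shift c01 bz rz rbe ee0 ez; lra.
have p1 := phir_gt0 br; have p2 := phitr_gt0 c01 br.
apply: (@sigma_perturbed_gt _ _ _ _ _ _ S _ _ _ (phir mu z - e) (phitr mu c z - e)).
- exact: z_pos.
- exact: lt_le_trans Xal alz.
- exact: lt_trans p1 s1.
- exact: lt_trans p2 s2.
- by move=> a b'; have /andP[] := dev_form a b' zI.
move=> j ji; have thj : t <= theta j by apply: svd_theta_noninc.
rewrite -(divff (x := t ^+ 2)); last by rewrite expf_eq0 /= gt_eqF.
apply: (@lt_le_trans _ _ (t ^+ 2 * ((phir mu z - e) * (phitr mu c z - e)))).
  rewrite ltr_pM2l ?exprn_gt0// -dr dreal_phir//.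
  by apply: ltr_pM; rewrite ?ltW.
rewrite ler_wpM2r//.
  by apply: mulr_ge0; apply: ltW; [exact: lt_trans p1 s1|exact: lt_trans p2 s2].
by apply: lerXn2r; rewrite // nnegrE ltW // svd_theta_gt0.
Qed.

End SpikeTracking.

(** The events of finitely many indices may be replaced by empty ones. *)
Lemma whp_eventually (R : realType) (disp : nat -> measure_display)
    (Om : forall n, measurableType (disp n)) (Pr : forall n, probability (Om n) R)
    (E E' : forall n, set (Om n)) :
  (\forall n \near \oo, E n `<=` E' n) -> whp Pr E -> whp Pr E'.
Proof.
case=> N _ HN [A [mA AE PA]].
exists (fun n => if (N <= n)%N then A n else set0); split.
- by move=> n; case: ifP.
- move=> n; case: ifP => [Nn|_]; last exact: sub0set.
  exact: subset_trans (AE n) (HN _ Nn).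
- apply: cvg_trans PA; apply: near_eq_cvg.
  by exists N => // n /= ->.
Qed.

Section SpikeCount.
Context {R : realType}.

Lemma ltn_card_ord_down r (A : pred 'I_r) (i : 'I_r) :
  (forall j k : 'I_r, (j <= k)%N -> A k -> A j) -> (i < #|A|)%N = A i.
Proof.
move=> Adown.
have cardlt m : (m <= r)%N -> #|[pred j : 'I_r | (j < m)%N]| = m.
  by move=> mr; rewrite -sum1_card (big_ord_narrow mr) sum1_card card_ord.
apply/idP/idP => [|Ai].
  apply: contraTT => nAi; rewrite -leqNgt -[leqRHS](cardlt i (ltnW (ltn_ord i))).
  apply/subset_leq_card/fintype.subsetP => j Aj; rewrite inE ltnNge.
  by apply: contra nAi => ij; exact: Adown Aj.
rewrite -(cardlt i.+1 (ltn_ord i)).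
by apply/subset_leq_card/fintype.subsetP => j; rewrite inE ltnS => ji; exact: Adown ji Ai.
Qed.

Context {F : base_field} {p q : nat}.
Variables (P : 'M[R[i]]_(p, q)) (S : thin_svd F P).

Lemma lt_spike_count lo (i : 'I_(\rank P)) :
  (i < spike_count S lo)%N = (lo <= svd_theta S 0 i).
Proof.
rewrite /spike_count (@ltn_card_ord_down _ [pred i | lo <= svd_theta S 0 i])//.
by move=> j k jk /= /le_trans; apply; exact: svd_theta_noninc.
Qed.

Lemma spike_count_le_rank lo : (spike_count S lo <= \rank P)%N.
Proof. by rewrite (leq_trans (max_card _)) ?card_ord. Qed.

Lemma svd_theta_le_opnorm (i : 'I_(\rank P)) :
  svd_theta S 0 i <= opnorm (rdiag (svd_theta S)).
Proof.
pose v : 'cV[R[i]]_(\rank P) := delta_mx i 0.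
have v0 : 0 < enorm v.
  rewrite lt_def enorm_ge0 andbT enorm_eq0; apply/eqP => /colP/(_ i)/eqP.
  by rewrite !mxE !eqxx oner_eq0.
have Dv : rdiag (svd_theta S) *m v = (svd_theta S 0 i)%:C *: v.
  rewrite /rdiag mul_diag_mx; apply/colP => j; rewrite !mxE.
  by case: eqVneq => [->|_]; rewrite ?mulr0.
have := enorm_mulmx_le (rdiag (svd_theta S)) v.
by rewrite Dv enormZ gtr0_norm ?svd_theta_gt0// ler_pM2r.
Qed.

Lemma sigma_noninc (W : 'M[R[i]]_(p, q)) i j : (i <= j)%N -> sigma W j <= sigma W i.
Proof.
move=> ij; rewrite /sigma; set s := map _ _.
have nth_ge0 k : 0 <= nth 0 s k.
  have [ks|sk] := ltnP k (size s); last by rewrite nth_default.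
  by rewrite (nth_map 0) ?sqrtr_ge0 //; move: ks; rewrite size_map.
have [js|sj] := ltnP j (size s); last by rewrite (nth_default _ sj).
have ss : sorted >=%R s.
  rewrite /s; apply: (@homo_sorted _ _ _ >=%R); first by move=> x y; exact: ler_wsqrtr.
  by apply: sort_sorted => a b; exact: le_total.
apply: (sorted_leq_nth _ _ 0 ss); rewrite ?inE//.
- by move=> a b d ab bd; exact: le_trans bd ab.
- exact: lexx.
- exact: leq_ltn_trans ij js.
Qed.

(** Both sequences are already in decreasing order, so that the bottleneck
    distance pairs them index by index. *)
Lemma bottleneck_leE (W : 'M[R[i]]_(p, q)) (f : R -> R) lo y : 0 <= y ->
  (forall s t, lo <= s -> s <= t -> f s <= f t) ->
  (forall i : 'I_(\rank P), (i < spike_count S lo)%N ->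
     `|sigma W i - f (svd_theta S 0 i)| <= y) <->
  bottleneck [seq sigma W i | i <- iota 0 (spike_count S lo)]
    [seq f (svd_theta S 0 i) |
      i : 'I_(\rank P) <- enum 'I_(\rank P) & (i < spike_count S lo)%N] <= y.
Proof.
move=> y0 fmono; have kr := spike_count_le_rank lo.
set k := spike_count S lo in kr *; set s1 := map (sigma W) _; set s2 := map _ (seq.filter _ _).
pose g j : R := if insub j is Some i then f (svd_theta S 0 (i : 'I_(\rank P))) else 0.
have gE (i : 'I_(\rank P)) : g i = f (svd_theta S 0 i) by rewrite /g valK.
have s2E : s2 = map g (iota 0 k).
  have -> : iota 0 k = map val [seq i : 'I_(\rank P) <- enum 'I_(\rank P) | (i < k)%N].
    rewrite -(filter_map val (fun i => i < k)%N) val_enum_ord.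
    by rewrite -{1}(subnKC kr) iotaD filter_cat; apply/esym;
      rewrite (all_filterP _) ?(eq_in_filter (a2 := pred0)) ?filter_pred0 ?cats0//;
      [move=> x; rewrite mem_iota => /andP[kx _]; rewrite ltnNge kx|
       apply/allP => x; rewrite mem_iota].
  by rewrite -map_comp /s2; apply: eq_map => i /=; rewrite gE.
have tr : transitive (>=%R : rel R) by move=> a b d ab bd; exact: le_trans bd ab.
have ss1 : sort >=%R s1 = s1.
  apply: sorted_sort => //; apply: (homo_sorted (e := leq)); last exact: iota_sorted.
  by move=> i j; exact: sigma_noninc.
have ss2 : sort >=%R s2 = s2.
  apply: sorted_sort => //; rewrite s2E.
  apply: (@homo_sorted_in _ _ [pred j | (j < k)%N] g leq); last exact: iota_sorted.
    move=> i j; rewrite !inE => ik jk ij.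
    have ir := leq_trans ik kr; have jr := leq_trans jk kr.
    rewrite /= (gE (Ordinal ir)) (gE (Ordinal jr)); apply: fmono.
      by rewrite -lt_spike_count.
    exact: svd_theta_noninc.
  by apply/allP => j; rewrite mem_iota.
rewrite /bottleneck ss1 ss2 size_map size_iota.
have nthE j : (j < k)%N -> nth 0 s1 j - nth 0 s2 j = sigma W j - g j.
  by move=> jk; rewrite s2E !(nth_map 0%N) ?size_iota// nth_iota.
split=> [H|/bigmax_leP[_ H] i ik].
  apply/bigmax_leP; split=> // j _; rewrite nthE//.
  have jr := leq_trans (ltn_ord j) kr.
  by have := H (Ordinal jr) (ltn_ord j); rewrite -gE.
by have := H (Ordinal ik) isT; rewrite nthE// gE.
Qed.

End SpikeCount.

Theorem theorem3p2 (R : realType) (F : base_field)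
    (disp : nat -> measure_display)
    (Om : forall n : nat, measurableType (disp n))
    (Pr : forall n : nat, probability (Om n) R)
    (m : nat -> nat) (c : R)
    (X P : forall n : nat, Om n -> 'M[R[i]]_(n, m n))
    (D : forall (n : nat) (w : Om n), thin_svd F (P n w))
    (mu : probability (measurableTypeR R) R)
    (delta M a1 a2 : R) :
  (forall n : nat, (n <= m n)%N) ->
  n%:R / (m n)%:R @[n --> \oo] --> c -> 0 < c <= 1 ->
  (forall (n : nat) (w : Om n), entries_over F (X n w)) ->
  (forall (n : nat) (w : Om n), entries_over F (P n w)) ->
  random_matrix X -> random_matrix P ->
  global_noise_law Pr X mu ->
  edge_condition mu c ->
  real_subspace_local_law Pr X mu c D ->
  0 < delta -> theta_star mu c + delta < M ->
  edge mu < a1 -> a1 <= a2 ->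
  rho mu c @` `[theta_star mu c + delta, M] `<=` interior `[a1, a2] ->
  weighted_compatibility Pr X mu c D (real_complex R @` `[a1, a2]) ->
  let lo := theta_star mu c + delta in
  let W n w : 'M[R[i]]_(n, m n) := X n w + P n w in
  let theta n w i := svd_theta (D n w) 0 i in
  let k n w := spike_count (D n w) lo in
  let maxdev n w : R :=
    \big[Num.max/0]_(i in spikes_in (D n w) lo M)
      `|sigma (W n w) i - rho mu c (theta n w i)| in
  exists eta : nat -> R,
    [/\ null_seq eta,
        whp Pr (fun n => [set w | maxdev n w <= eta n]),
        weighted_compatibility_near Pr X mu c D (rho mu c lo) ->
          whp Pr (fun n => [set w |
            sigma (W n w) (k n w) <= rho mu c lo + eta n]) &
        forall (n : nat) (w : Om n),
          opnorm (rdiag (svd_theta (D n w))) <= M ->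
          (forall i : 'I_(\rank (P n w)),
             (i < k n w)%N -> i \in spikes_in (D n w) lo M) /\
          (maxdev n w <= eta n <->
           bottleneck [seq sigma (W n w) i | i <- iota 0 (k n w)]
             [seq rho mu c (theta n w i) |
               i : 'I_(\rank (P n w)) <- enum 'I_(\rank (P n w)) &
               (i < k n w)%N] <= eta n)].

Proof.
move=> _ _ c01 _ _ _ _ [mu_ge0 mu_cpt _ _] edge_cond local_law delta0 loM _ _ _ _.
move=> lo W theta k maxdev.
have ts_lo : theta_star mu c < lo by rewrite ltrDl.
have [b_lo _] := rho_spec mu_ge0 mu_cpt c01 edge_cond ts_lo.
have rho_mono s t : lo <= s -> s <= t -> rho mu c s <= rho mu c t.
  by move=> los; apply: rho_le => //; exact: lt_le_trans ts_lo los.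
set b := edge mu in b_lo *.
(* The local law is used on [[al, be]], a neighbourhood in [(b, +oo)] of the
   range of [rho] on [[lo, M]]. *)
pose al := (b + rho mu c lo) / 2; pose be := rho mu c M + 1.
have al_gt : b < al by rewrite /al; lra.
have al_lo : al < rho mu c lo by rewrite /al; lra.
have lo_M : rho mu c lo <= rho mu c M by exact: rho_mono _ _ (lexx lo) (ltW loM).
have al_be : al <= be by rewrite /be; lra.
have [eps [[eps0 eps_cvg] law]] := local_law al be al_gt al_be.
have be2 : 0 < be ^+ 2.
  by rewrite exprn_gt0// (le_lt_trans (edge_ge0 mu))// (lt_le_trans al_gt).
(* The term [1 / (n + 1)] makes the inequality [be^2 eps < eta] strict. *)
pose eta n := be ^+ 2 * (eps n + n.+1%:R^-1).
have eta0 n : 0 <= eta n by rewrite mulr_ge0 ?(ltW be2)// addr_ge0// invr_ge0.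
have eps_eta n : be ^+ 2 * eps n < eta n by rewrite ltr_pM2l// ltrDl invr_gt0.
have eta_cvg : eta n @[n --> \oo] --> 0.
  rewrite -(mulr0 (be ^+ 2)); apply: cvgMr; rewrite -[X in _ --> X]addr0.
  by apply: cvgD => //; exact: cvg_harmonic.
pose small n := eta n <= 1 /\ eta n <= rho mu c lo - al.
have small_near : \forall n \near \oo, small n.
  have h1 : \forall n \near \oo, eta n <= 1 by exact: (cvgr_le _ eta_cvg).
  have h2 : \forall n \near \oo, eta n <= rho mu c lo - al.
    by apply: (cvgr_le _ eta_cvg); rewrite subr_gt0.
  by apply: filterS2 h1 h2 => n; split.
have dev n w : (ereal_sup [set (opnorm (deviation X mu c D w z%:C))%:E | z in `[al, be]]
        <= (eps n)%:E)%E -> forall z, al <= z <= be ->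
    opnorm (compressed_resolvent (X n w) (D n w) z%:C - Mlim mu c _ z%:C) <= eps n.
  move=> h z zI; rewrite -lee_fin; apply: le_trans h.
  by apply: ereal_sup_ubound; exists z.
exists eta; split.
- by split.
- apply: whp_eventually law; apply: filterS small_near => n [eta1 eta2] w /= [Xal /dev devw].
  apply/bigmax_leP; split=> // i /andP[/= lo_i i_M].
  have ts_i := lt_le_trans ts_lo lo_i.
  have r1 := rho_mono _ _ (lexx lo) lo_i; have r2 := rho_mono _ _ lo_i i_M.
  rewrite ler_distl; apply/andP; split.
    by apply: ltW; apply: (sigma_gt_rho _ _ _ _ _ Xal devw); rewrite // /be; lra.
  apply: (sigma_le_rho _ _ _ _ _ Xal devw); rewrite // ?/be; do ?lra.
  by move=> j ij; apply: svd_theta_noninc.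
- move=> _; apply: whp_eventually law.
  apply: filterS small_near => n [eta1 eta2] w /= [Xal /dev devw].
  apply: (sigma_le_rho _ _ _ _ _ Xal devw); rewrite // ?/be; do ?lra.
  move=> j kj; apply: ltW; rewrite ltNge -lt_spike_count -leqNgt; exact: kj.
- move=> n w opM.
  have inE' (i : 'I_(\rank (P n w))) : (i \in spikes_in (D n w) lo M) = (i < k n w)%N.
    rewrite inE /= lt_spike_count; case: (lo <= _) => //=.
    exact: le_trans (svd_theta_le_opnorm _ _) opM.
  split=> [i|]; first by rewrite inE'.
  apply: iff_trans (bottleneck_leE (D n w) (W n w) (eta0 n) rho_mono).
  split=> [/bigmax_leP[_ H] i ik|H]; first by apply: H; rewrite inE'.
  by apply/bigmax_leP; split=> // i; rewrite inE'; exact: H.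
Qed.
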